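(* Let $w=(w_k)_{k\ge0}$ be any weight sequence with $w_0>0$ and $w_k>0$ for some $k\ge1$. Suppose that $n\to\infty$ and $m=m(n)$ with $m/n\to\lambda$, where $0\le\lambda<\omega$. (i) If $\lambda\le\nu$, let $\tau$ be the unique number in $[0,\rho]$ such that $\Psi(\tau)=\lambda$. (ii) If $\lambda>\nu$, let $\tau=\rho$. In both cases $0\le\tau<\infty$ and $0<\Phi(\tau)<\infty$. Let $\pi_k=w_k\tau^k/\Phi(\tau)$, $k\ge0$. Then $(\pi_k)_{k\ge0}$ is a probability distribution with expectation $\mu=\Psi(\tau)=\min(\lambda,\nu)$ and variance $\sigma^2=\tau\Psi'(\tau)\le\infty$. Moreover, for every $k\ge0$, $N_k(B_{m,n})/n\to\pi_k$ in probability.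
   Context: A weight sequence is a sequence $w=(w_k)_{k\ge0}$ of nonnegative reals; $\omega=\sup\{k:w_k>0\}\le\infty$. $\Phi(t)=\sum_{k\ge0}w_kt^k$, $\rho\in[0,\infty]$ its radius of convergence; for $t$ with $\Phi(t)<\infty$, $\Psi(t)=t\Phi'(t)/\Phi(t)=\sum_kkw_kt^k/\sum_kw_kt^k$; if $\Phi(\rho)=\infty$, $\Psi(\rho)=\lim_{t\uparrow\rho}\Psi(t)$; $\nu=\Psi(\rho)$; at $\tau=\rho$, $\Psi'(\tau)$ means $\lim_{s\uparrow\rho}\Psi'(s)$. Convention $0^0=1$. Balls-in-boxes: for integers $m\ge0,n\ge1$ let $\mathcal B_{m,n}=\{(y_1,\dots,y_n)\in\{0,1,2,\dots\}^n:\sum_iy_i=m\}$, with weight $w(y)=\prod_{i=1}^nw_{y_i}$ and $Z(m,n)=\sum_{y\in\mathcal B_{m,n}}w(y)$. When $Z(m,n)>0$, $B_{m,n}=(Y_1,\dots,Y_n)$ is the random element of $\mathcal B_{m,n}$ with $P(B_{m,n}=y)=w(y)/Z(m,n)$ (limit statements are along $n$ with $Z(m,n)>0$). $N_k(y)=|\{i:y_i=k\}|$. *)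

(* Defs.v *)
From HB Require Import structures.
From mathcomp Require Import all_boot all_order all_algebra.
From mathcomp Require Import all_classical all_reals all_analysis.
Set Implicit Arguments. Unset Strict Implicit. Unset Printing Implicit Defensive.
Import Order.TTheory GRing.Theory Num.Theory.
Import numFieldNormedType.Exports.
Local Open Scope classical_set_scope.
Local Open Scope ring_scope.

Section WeightSeq.
Variable R : realType.
Variable w : nat -> R.

Definition PhiE (t : R) : \bar R := (\sum_(k <oo) (w k * t ^+ k)%:E)%E.

Definition omega : \bar R :=
  ereal_sup [set (k%:R)%:E | k in [set k : nat | 0 < w k]].

(* rho = radius of convergence of Phi (nonnegative coefficients):
   sup of the t >= 0 at which the series converges *)
Definition rho : \bar R :=
  ereal_sup [set t%:E | t in [set t : R | 0 <= t /\ (PhiE t < +oo)%E]].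

Definition PsiE (t : R) : \bar R :=
  ((\sum_(k <oo) (k%:R * w k * t ^+ k)%:E) * ((fine (PhiE t))^-1)%:E)%E.

Definition nu : \bar R :=
  match rho with
  | r%:E => if (PhiE r < +oo)%E then PsiE r
            else lim (PsiE t @[t --> r^'-])
  | +oo%E => lim (PsiE t @[t --> +oo])
  | -oo%E => 0%E
  end.

Definition PsiX (t : R) : \bar R := if t%:E == rho then nu else PsiE t.

(* real-valued Psi (analytic on (-rho, rho) near [0,rho)), used for Psi' *)
Definition PsiR (t : R) : R :=
  limn (series (fun k => k%:R * w k * t ^+ k)) /
  limn (series (fun k => w k * t ^+ k)).

Definition PsiD (t : R) : \bar R :=
  if (t%:E < rho)%E then (derive1 PsiR t)%:E
  else lim ((derive1 PsiR s)%:E @[s --> t^'-]).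

(* Balls in boxes.  B_{m,n} is encoded as functions 'I_n -> 'I_(m.+1)
   (every entry of an element of B_{m,n} is <= m) with sum m. *)
Definition Bset (m n : nat) : {set {ffun 'I_n -> 'I_m.+1}} :=
  [set y : {ffun 'I_n -> 'I_m.+1} | (\sum_(i < n) (y i : nat))%N == m].

Definition wt (m n : nat) (y : {ffun 'I_n -> 'I_m.+1}) : R :=
  \prod_(i < n) w (y i).

Definition Z (m n : nat) : R := \sum_(y in Bset m n) wt y.

Definition Prob (m n : nat) (E : pred {ffun 'I_n -> 'I_m.+1}) : R :=
  (\sum_(y in Bset m n | E y) wt y) / Z m n.

End WeightSeq.

Definition Nk (k m n : nat) (y : {ffun 'I_n -> 'I_m.+1}) : nat :=
  #|[set i | (y i : nat) == k]|.

(* Main.v *)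
(*
With pi_k = w_k tau^k / Phi(tau), tilting turns Z(m,n) into P(S_n = m) for a sum
S_n of n independent variables of law pi, without changing the law of B_{m,n}.
Under the independent law, N_k / n deviates from pi_k with probability at most
e^{-cn} (Chernoff), so it suffices that P(S_n = m) decays subexponentially.  For
this, almost all boxes are filled in a typical way for a truncated version of pi,
which uses up about mu n; the missing part is supplied by o(n) further boxes
that repeat one fixed value L.  When mu = lam any L > lam with w_L > 0 will do;
when mu = nu < lam, tau is the radius of convergence, so pi_L >= e^{-eps L} for
arbitrarily large L.  The remaining lattice obstruction is a residue modulo L:
the residues of sums of support elements form a finite submonoid, hence a
subgroup, of Z/L, so boundedly many boxes repair it.

If tau = 0 there is nothing to tilt.  For lam = 0 almost all boxes are trivially
empty.  For rho = 0 < lam one expands the moment generating function of N_k: since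
j boxes of total kj can be given superexponential weight by using few boxes of a
large value, each N_k with k >= 1 is o(n).

On the analytic side, Psi is strictly increasing because (k - c)(x^k - x^c) >= 0
for x > 1, and bounding the partial sums of (k - c) w_k t^k shows that Psi is
unbounded near rho if Phi(rho) is infinite, and exceeds every lam < omega if rho
is infinite.
*)
Require Import Defs.
From HB Require Import structures.
From mathcomp Require Import all_boot all_order all_algebra.
From mathcomp Require Import all_classical all_reals all_analysis.
From mathcomp Require Import ring lra zify.
Import Order.TTheory GRing.Theory Num.Theory.
Import numFieldNormedType.Exports.
Local Open Scope classical_set_scope.
Local Open Scope ring_scope.

(** * Partition functions as polynomial coefficients *)

(** Cutting Phi off at degree [N] keeps all coefficients below [N], so inequalities between
    partition functions become inequalities between coefficients of genuine polynomials. *)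
Definition wpoly {R : realType} (w : nat -> R) (N : nat) : {poly R} :=
  \poly_(k < N) w k.

Lemma coef_exp_agree {R : realType} (p q : {poly R}) (M n : nat) :
  (forall k, (k <= M)%N -> p`_k = q`_k) ->
  forall k, (k <= M)%N -> (p ^+ n)`_k = (q ^+ n)`_k.
Proof.
move=> pq; elim: n => [|n IH] k kM; first by rewrite !expr0.
rewrite !exprS !coefM; apply: eq_bigr => -[i /= ilt] _.
rewrite pq ?IH //; first exact: leq_trans (leq_subr _ _) kM.
by apply: leq_trans kM; rewrite -ltnS.
Qed.

(** Truncated at [m.+1], the polynomial is a sum over the very type of the entries of a box
    configuration, and distributing the [n]-th power yields one monomial per configuration. The free
    bound [N] lets several partition functions be read off powers of one polynomial. *)
Lemma Z_coef {R : realType} (w : nat -> R) (N m n : nat) : (m < N)%N ->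
  Z w m n = (wpoly w N ^+ n)`_m.
Proof.
move=> mN; rewrite -(coef_exp_agree (wpoly w m.+1) _ m n) //; last first.
  by move=> k km; rewrite !coef_poly ltnS km (leq_ltn_trans km mN).
rewrite /wpoly poly_def.
have -> : (\sum_(i < m.+1) w i *: 'X^i : {poly R}) ^+ n =
    \prod_(j < n) \sum_(i < m.+1) w i *: 'X^i.
  by rewrite prodr_const card_ord.
rewrite bigA_distr_bigA coef_sum /Z big_mkcond /=; apply: eq_bigr => f _.
rewrite scaler_prod prodrXr coefZ coefXn inE [m == _]eq_sym.
by case: eqP => _; rewrite ?mulr1 ?mulr0.
Qed.

Lemma coef_wpoly_exp_ge0 {R : realType} (w : nat -> R) (N n k : nat) :
  (forall k, 0 <= w k) -> 0 <= (wpoly w N ^+ n)`_k.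
Proof.
move=> w0; elim: n k => [|n IH] k; first by rewrite expr0 coef1 ler0n.
rewrite exprS coefM; apply: sumr_ge0 => i _; apply: mulr_ge0 => //.
by rewrite coef_poly; case: ifP.
Qed.

Lemma Z_ge0 {R : realType} (w : nat -> R) (m n : nat) :
  (forall k, 0 <= w k) -> 0 <= Z w m n.
Proof. by move=> w0; rewrite (Z_coef w m.+1)// coef_wpoly_exp_ge0. Qed.

(** Filling the first [n1] boxes with total [m1] and the others with total [m2] is one way among
    many: a single term of the convolution is kept. *)
Lemma Z_supermul {R : realType} (w : nat -> R) (m1 n1 m2 n2 : nat) :
  (forall k, 0 <= w k) ->
  Z w m1 n1 * Z w m2 n2 <= Z w (m1 + m2) (n1 + n2).
Proof.
move=> w0; rewrite !(Z_coef w (m1 + m2).+1) ?ltnS ?leq_addr ?leq_addl //.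
have m1lt : (m1 < (m1 + m2).+1)%N by rewrite ltnS leq_addr.
rewrite exprD coefM (bigD1 (Ordinal m1lt)) //= addKn lerDl.
by apply: sumr_ge0 => i _; apply: mulr_ge0; apply: coef_wpoly_exp_ge0.
Qed.

Lemma Z00 {R : realType} (w : nat -> R) : Z w 0 0 = 1.
Proof. by rewrite (Z_coef w 1)// expr0 coef1. Qed.

Lemma Z_box1 {R : realType} (w : nat -> R) (k : nat) : Z w k 1 = w k.
Proof. by rewrite (Z_coef w k.+1)// expr1 coef_poly ltnSn. Qed.

Lemma Z_pow {R : realType} (w : nat -> R) (m n j : nat) :
  (forall k, 0 <= w k) -> Z w m n ^+ j <= Z w (m * j) (n * j).
Proof.
move=> w0; elim: j => [|j IH]; first by rewrite !muln0 expr0 Z00.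
rewrite !mulnS exprS; apply: le_trans (Z_supermul w _ _ _ _ w0).
by apply: ler_wpM2l => //; apply: Z_ge0.
Qed.

Lemma Z_const {R : realType} (w : nat -> R) (k j : nat) :
  (forall k, 0 <= w k) -> w k ^+ j <= Z w (k * j) j.
Proof. by move=> w0; rewrite -(Z_box1 w); have := Z_pow w k 1 j w0; rewrite mul1n. Qed.

(** * Tilting and reweighting *)

Lemma wt_ge0 {R : realType} (w : nat -> R) (m n : nat)
    (y : {ffun 'I_n -> 'I_m.+1}) : (forall k, 0 <= w k) -> 0 <= wt w y.
Proof. by move=> w0; apply: prodr_ge0. Qed.

(** The powers of [t] multiply to [t] to the total, which is [m] on all of [Bset m n]; hence a tilt
    scales all weights alike and leaves the law unchanged. *)
Lemma wt_tilt {R : realType} (w : nat -> R) (c t : R) (m n : nat)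
    (y : {ffun 'I_n -> 'I_m.+1}) : y \in Bset m n ->
  wt (fun k => c * (w k * t ^+ k)) y = c ^+ n * t ^+ m * wt w y.
Proof.
rewrite inE => /eqP {2}<-.
rewrite /wt !big_split /= prodr_const card_ord prodrXr; ring.
Qed.

Lemma Z_tilt {R : realType} (w : nat -> R) (c t : R) (m n : nat) :
  Z (fun k => c * (w k * t ^+ k)) m n = c ^+ n * t ^+ m * Z w m n.
Proof. by rewrite /Z mulr_sumr; apply: eq_bigr => y /wt_tilt. Qed.

Lemma Prob_tilt {R : realType} (w : nat -> R) (c t : R) (m n : nat)
    (E : pred {ffun 'I_n -> 'I_m.+1}) : c != 0 -> t != 0 ->
  Prob (fun k => c * (w k * t ^+ k)) E = Prob w E.
Proof.
move=> c0 t0; rewrite /Prob Z_tilt.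
have -> : \sum_(y in Bset m n | E y) wt (fun k => c * (w k * t ^+ k)) y =
    c ^+ n * t ^+ m * \sum_(y in Bset m n | E y) wt w y.
  by rewrite mulr_sumr; apply: eq_bigr => y /andP[yB _]; rewrite wt_tilt.
by rewrite -mulf_div divff ?mul1r// mulf_neq0 ?expf_neq0.
Qed.

(** Each box containing [k] is marked by a factor [x], so the ratio of the new partition function to
    the old one is the expectation of [x ^+ Nk k y]. *)
Definition reweight {R : realType} (w : nat -> R) (k : nat) (x : R) : nat -> R :=
  fun j => if j == k then x * w j else w j.

Lemma reweight_ge0 {R : realType} (w : nat -> R) (k : nat) (x : R) :
  (forall k, 0 <= w k) -> 0 <= x -> forall j, 0 <= reweight w k x j.
Proof. by move=> w0 x0 j; rewrite /reweight; case: eqP => // _; rewrite mulr_ge0. Qed.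

Lemma NkE (k m n : nat) (y : {ffun 'I_n -> 'I_m.+1}) :
  Nk k y = (\sum_(i < n) ((y i : nat) == k))%N.
Proof.
rewrite /Nk -sum1_card big_mkcond; apply: eq_bigr => i _.
rewrite (_ : (i \in _) = ((y i : nat) == k)); first by case: eqP.
by apply/idP/idP => [/set_mem|/mem_set].
Qed.

Lemma wt_reweight {R : realType} (w : nat -> R) (k : nat) (x : R) (m n : nat)
    (y : {ffun 'I_n -> 'I_m.+1}) :
  wt (reweight w k x) y = x ^+ Nk k y * wt w y.
Proof.
rewrite /wt NkE -prodrXr -big_split /=; apply: eq_bigr => i _.
by rewrite /reweight; case: eqP; rewrite ?expr1 ?mul1r.
Qed.

Lemma Prob_le {R : realType} (w : nat -> R) (m n : nat)
    (E F : pred {ffun 'I_n -> 'I_m.+1}) : (forall k, 0 <= w k) ->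
  (forall y, y \in Bset m n -> E y -> F y) -> Prob w E <= Prob w F.
Proof.
move=> w0 EF; rewrite /Prob ler_wpM2r ?invr_ge0 ?Z_ge0//.
rewrite big_mkcondr [leRHS]big_mkcondr; apply: ler_sum => y yB.
case: ifPn => [/(EF _ yB)->//|_]; by case: ifP => // _; apply: wt_ge0.
Qed.

Lemma Prob_or {R : realType} (w : nat -> R) (m n : nat)
    (E F : pred {ffun 'I_n -> 'I_m.+1}) : (forall k, 0 <= w k) ->
  Prob w (fun y => E y || F y) <= Prob w E + Prob w F.
Proof.
move=> w0; rewrite /Prob -mulrDl ler_wpM2r ?invr_ge0 ?Z_ge0//.
rewrite !big_mkcondr -big_split /=; apply: ler_sum => y yB.
have := @wt_ge0 _ w _ _ y w0.
by case: (E y); case: (F y) => /= ?; rewrite ?addr0 ?add0r ?lerDl.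
Qed.

Lemma Prob_markov {R : realType} (w : nat -> R) (k : nat) (x B : R) (m n : nat)
    (E : pred {ffun 'I_n -> 'I_m.+1}) : (forall k, 0 <= w k) ->
  0 <= x -> 0 < B ->
  (forall y, y \in Bset m n -> E y -> B <= x ^+ Nk k y) ->
  Prob w E <= Z (reweight w k x) m n / (B * Z w m n).
Proof.
move=> w0 x0 B0 EB; rewrite /Prob invfM mulrA ler_wpM2r ?invr_ge0 ?Z_ge0//.
rewrite ler_pdivlMr// mulr_suml /Z big_mkcondr; apply: ler_sum => y yB.
rewrite wt_reweight; case: ifPn => [/(EB _ yB) Bx|_]; last first.
  by rewrite mulr_ge0 ?exprn_ge0 ?wt_ge0.
by rewrite mulrC ler_wpM2r ?wt_ge0.
Qed.

(** The left side is a single term of a polynomial with nonnegative coefficients evaluated at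
    [t]. *)
Lemma Z_le_horner {R : realType} (w : nat -> R) (t : R) (m n : nat) :
  (forall k, 0 <= w k) -> 0 <= t ->
  Z w m n * t ^+ m <= (\sum_(k < m.+1) w k * t ^+ k) ^+ n.
Proof.
move=> w0 t0; rewrite -(horner_poly m.+1 w) -/(wpoly w _) -horner_exp.
rewrite (Z_coef w m.+1)//; set p := wpoly w m.+1 ^+ n.
have p0 k : 0 <= p`_k by apply: coef_wpoly_exp_ge0.
rewrite horner_coef; case: (ltnP m (size p)) => ms; last first.
  rewrite nth_default// mul0r; apply: sumr_ge0 => i _.
  by rewrite mulr_ge0 ?exprn_ge0.
rewrite (bigD1 (Ordinal ms)) //= lerDl; apply: sumr_ge0 => i _.
by rewrite mulr_ge0 ?exprn_ge0.
Qed.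

(** * A subexponential lower bound for the partition function *)

Lemma exists_descent {R : realType} (h : R -> R) (d : R) :
  is_derive (0 : R) (1 : R) h d -> d < 0 -> exists s, 0 < s /\ h s < h 0.
Proof.
move=> [hd hE] d0.
have : \forall t \near (0:R)^', t^-1 *: (h (t *: (1 : R) + 0) - h 0) < 0.
  have /cvgr_lt H : t^-1 *: (h (t *: (1 : R) + 0) - h 0) @[t --> (0:R)^'] --> d.
    by rewrite -hE; exact: hd.
  exact: H.
move=> /nbhs_ballP[e /= e0 He].
have e20 : 0 < e / 2 by rewrite divr_gt0.
exists (e / 2); split => //.
have := He (e / 2); rewrite /ball /= sub0r normrN gtr0_norm//.
rewrite ltr_pdivrMr// ltr_pMr// ltr1n => /(_ isT).
rewrite gt_eqF// => /(_ isT).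
by rewrite /GRing.scale /= mulr1 addr0 pmulr_rlt0 ?invr_gt0// subr_lt0.
Qed.

(* The two signs of [c] give the upper and the lower Chernoff bound. *)
Lemma chernoff_tilt {R : realType} (p : {poly R}) (a c : R) :
  c * p^`().[1] < c * (a * p.[1]) ->
  exists s, 0 < s /\ p.[expR (c * s)] < p.[1] * expR (a * (c * s)).
Proof.
move=> Hp.
have E1 (b : R) : is_derive (0 : R) (1 : R) (expR \o (b \*: id)) b.
  apply: is_derive_eq.
  by rewrite /= /GRing.scale /= mulr0 expR0 mul1r mulr1.
(* [h] vanishes at 0, where its derivative is c (p'(1) - a p(1)) < 0; it is therefore negative at
   some [s > 0]. *)
pose h := (horner p \o (expR \o (c \*: id))) - p.[1] \*: (expR \o ((a * c) \*: id)).
have hE s : h s = p.[expR (c * s)] - p.[1] * expR (a * (c * s)).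
  by rewrite mulrA.
have [] := @exists_descent R h (c * p^`().[1] - c * (a * p.[1])).
- rewrite /h; apply: is_derive_eq.
  by rewrite /= /GRing.scale /= mulr0 expR0; ring.
- by rewrite subr_lt0.
- move=> s [s0]; rewrite !hE !mulr0 expR0 mulr1 subrr subr_lt0 => hs.
  by exists s.
Qed.

Lemma coef_exp_le {R : realType} (p q : {poly R}) (n k : nat) :
  (forall i, 0 <= p`_i <= q`_i) -> 0 <= (p ^+ n)`_k <= (q ^+ n)`_k.
Proof.
move=> pq; elim: n k => [|n IH] k; first by rewrite !expr0 lexx coef1 ler0n.
rewrite !exprS !coefM; apply/andP; split.
  by apply: sumr_ge0 => i _; case/andP: (pq i) (IH (k - i)%N) => ? _ /andP[? _]; apply: mulr_ge0.
apply: ler_sum => i _; case/andP: (pq i) (IH (k - i)%N) => ? ? /andP[? ?].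
exact: ler_pM.
Qed.

Lemma coef_wpoly_exp_le_Z {R : realType} (w : nat -> R) (K m n : nat) :
  (forall k, 0 <= w k) -> (wpoly w K ^+ n)`_m <= Z w m n.
Proof.
move=> w0; rewrite (Z_coef w (maxn m.+1 K)); last by rewrite leq_max ltnSn.
suff /andP[] : 0 <= (wpoly w K ^+ n)`_m <= (wpoly w (maxn m.+1 K) ^+ n)`_m by [].
apply: coef_exp_le => i; rewrite !coef_poly leq_max.
by case: (ltnP i K) => _; rewrite ?orbT ?w0 ?lexx//=; case: ifP.
Qed.

Lemma expR_dominates_linear {R : realType} (e A : R) : 0 < e ->
  exists N : nat, forall n : nat, (N <= n)%N -> A * n.+1%:R <= expR (e * n%:R).
Proof.
(* From exp(y) >= y^2/2 with y = e n, and n + 1 <= 2 n for n >= 1, it is enough that 4 |A| <= e^2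
   n. *)
move=> e0; exists (Num.truncn (1 + 4 * `|A| / e ^+ 2)).+1 => n Nn.
have nN : 1 + 4 * `|A| / e ^+ 2 <= n%:R.
  by apply: le_trans (ltW (truncnS_gt _)) _; rewrite ler_nat.
have n1 : 1 <= n%:R :> R.
  by apply: le_trans nN; rewrite lerDl !mulr_ge0// invr_ge0 sqr_ge0.
have An : 4 * `|A| <= e ^+ 2 * n%:R.
  rewrite [leRHS]mulrC -ler_pdivrMr ?exprn_gt0//.
  by apply: le_trans nN; rewrite lerDr.
apply: le_trans (expR_ge1Dxn 1 _); last by rewrite mulr_ge0// ltW.
rewrite factE /=; have := ler_norm A.
rewrite exprMn -natr1.
have : 0 <= `|A| by [].
set a := `|A|; set x := n%:R; move=> a0 Aa.
have H : A * (x + 1) <= a * (2 * x).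
  by apply: (@le_trans _ _ (a * (x + 1))); [apply: ler_wpM2r|apply: ler_wpM2l]; nra.
have H2 : 4 * a * x <= e ^+ 2 * x * x.
  by apply: ler_wpM2r => //; apply: le_trans n1.
have -> : (2 * 1)%:R = 2 :> R by [].
rewrite (_ : x ^+ 2 = x * x)// mulrA; lra.
Qed.

(* Under the tilted law with weights [w k / P.[1]], a sum of [n] boxes stays
   between [a n] and [b n] with high probability, so one value carries at least
   the average of half of the mass. *)
Lemma exists_typical_sum {R : realType} (w : nat -> R) (K : nat) (a b : R) :
  let P := wpoly w K in
  (forall k, 0 <= w k) -> 0 < P.[1] ->
  a * P.[1] < P^`().[1] -> P^`().[1] < b * P.[1] ->
  exists N : nat, forall n : nat, (N <= n)%N -> exists m : nat,
    [/\ a * n%:R <= m%:R, m%:R <= b * n%:R &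
      P.[1] ^+ n <= 2 * (K * n).+1%:R * Z w m n].
Proof.
move=> P w0 P1 aP Pb.
(* Both tails at once: [c = 1] is used above [b n] and [c = -1] below [a n]. The factor 1/5 leaves
   room, since 1/2 + 1/5 + 1/5 < 1. *)
have tail (c d : R) : c * P^`().[1] < c * (d * P.[1]) -> exists (s : R) (N : nat),
    0 < s /\ forall n : nat, (N <= n)%N ->
      (P ^+ n).[expR (c * s)] * expR (- (d * (c * s)) * n%:R) <= (P ^+ n).[1] / 5.
  move=> /chernoff_tilt[s [s0 Hs]].
  have Px x : 0 <= x -> 0 <= P.[x].
    by move=> x0; rewrite horner_poly sumr_ge0// => i _; rewrite mulr_ge0 ?exprn_ge0.
  (* The Chernoff factor contributed by one box; it is below 1, so its powers tend to 0. *)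
  pose th := P.[expR (c * s)] / P.[1] * expR (- (d * (c * s))).
  have th0 : 0 <= th by rewrite !mulr_ge0 ?invr_ge0 ?Px ?expR_ge0.
  have th1 : th < 1.
    by rewrite /th expRN ltr_pdivrMr ?expR_gt0// mul1r ltr_pdivrMr// [ltRHS]mulrC.
  have /cvgr_lt thc : th ^+ n @[n --> \oo] --> 0 by apply: cvg_expr; rewrite ger0_norm.
  have [|N _ HN] := thc 5^-1 _; first by rewrite invr_gt0.
  exists s, N; split => // n /HN /= thn.
  have -> : (P ^+ n).[expR (c * s)] * expR (- (d * (c * s)) * n%:R) =
      (P ^+ n).[1] * th ^+ n.
    rewrite /th !horner_exp expRM_natr -!exprMn; congr (_ ^+ _).
    by rewrite [RHS]mulrA [P.[1] * _]mulrC divfK// gt_eqF.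
  by rewrite ler_wpM2l ?ltW// horner_exp exprn_gt0.
have [|s [N1 [s0 H1]]] := tail 1 b; first by rewrite !mul1r.
have [|s' [N2 [s'0 H2]]] := tail (-1) a; first by rewrite !mulN1r ltrN2.
exists (maxn N1 N2) => n; rewrite geq_max => /andP[/H1 {}H1 /H2 {}H2].
apply: contrapT => Hno; set q := P ^+ n in H1 H2.
have q0 i : 0 <= q`_i by apply: coef_wpoly_exp_ge0.
have szq : (size q <= (K * n).+1)%N.
  apply: leq_trans (size_poly_exp_leq _ _) _; rewrite ltnS leq_mul2r.
  by rewrite (leq_trans (leq_pred _) (size_poly _ _)) orbT.
have q1 : 0 < q.[1] by rewrite horner_exp exprn_gt0.
pose M := (K * n).+1; have M0 : 0 < M%:R :> R by rewrite ltr0n.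
have /negP := lt_irreflexive q.[1]; apply.
have -> : q.[1] = \sum_(i < M) q`_i.
  by rewrite (horner_coef_wide _ szq); apply: eq_bigr => i _; rewrite expr1n mulr1.
(* If no coefficient in the window reaches [q.[1] / (2 M)], then one of the three nonnegative terms
   dominates each coefficient: the first inside the window, the second above it, the third below it.
   Summing over [i] gives less than [q.[1]], a contradiction. *)
have bound (i : 'I_M) : q`_i <= q.[1] / (2 * M%:R) +
    q`_i * expR (1 * s) ^+ i * expR (- (b * (1 * s)) * n%:R) +
    q`_i * expR (-1 * s') ^+ i * expR (- (a * (-1 * s')) * n%:R).
  have p1 : 0 <= q.[1] / (2 * M%:R) by rewrite divr_ge0 ?mulr_ge0 ?ltW.
  have p2 : 0 <= q`_i * expR (1 * s) ^+ i * expR (- (b * (1 * s)) * n%:R).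
    by rewrite !mulr_ge0 ?exprn_ge0 ?expR_ge0.
  have p3 : 0 <= q`_i * expR (-1 * s') ^+ i * expR (- (a * (-1 * s')) * n%:R).
    by rewrite !mulr_ge0 ?exprn_ge0 ?expR_ge0.
  have [ai|ai] := leP (a * n%:R) i%:R; last first.
    suff : q`_i <= q`_i * expR (-1 * s') ^+ i * expR (- (a * (-1 * s')) * n%:R) by lra.
    rewrite -mulrA ler_peMr// -expRM_natr -expRD -[leLHS]expR0 ler_expR; nra.
  have [ib|ib] := leP i%:R (b * n%:R); last first.
    suff : q`_i <= q`_i * expR (1 * s) ^+ i * expR (- (b * (1 * s)) * n%:R) by lra.
    rewrite -mulrA ler_peMr// -expRM_natr -expRD -[leLHS]expR0 ler_expR; nra.
  suff : q`_i <= q.[1] / (2 * M%:R) by lra.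
  rewrite leNgt; apply/negP => qi; apply: Hno; exists i; split => //.
  rewrite -horner_exp -/q -ler_pdivrMl ?mulr_gt0// mulrC.
  by apply: le_trans (ltW qi) _; apply: coef_wpoly_exp_le_Z.
apply: (@le_lt_trans _ _ (q.[1] / 2 + q.[1] / 5 + q.[1] / 5)); last first.
  rewrite -[X in _ < X](_ : q.[1] = _); first by lra.
  by rewrite (horner_coef_wide _ szq); apply: eq_bigr => i _; rewrite expr1n mulr1.
apply: le_trans (ler_sum _ (fun i _ => bound i)) _.
rewrite !big_split /= sumr_const card_ord -!mulr_suml -!(horner_coef_wide _ szq).
apply: lerD => //; apply: lerD => //.
by rewrite -[leLHS]mulr_natr -ler_pdivlMr// -[leRHS]mulrA -invfM.
Qed.

(** There are finitely many residues, so one attainable pair can be picked for each attainable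
    residue and the bounds taken uniform over these picks. The induction on [j] treats the residues
    below [j]. *)
Lemma exists_residue_representatives {R : realType} (w : nat -> R) (L : nat) :
  exists (V C : nat) (kap : R), 0 < kap /\ forall v c, 0 < Z w v c ->
    exists v' c', [/\ (v' <= V)%N, (c' <= C)%N, v' = v %[mod L.+1] &
      kap <= Z w v' c'].
Proof.
suff H j : exists (V C : nat) (kap : R), 0 < kap /\
    forall v c, (v %% L.+1 < j)%N -> 0 < Z w v c ->
    exists v' c', [/\ (v' <= V)%N, (c' <= C)%N, v' = v %[mod L.+1] &
      kap <= Z w v' c'].
  have [V [C [kap [k0 {}H]]]] := H L.+1; exists V, C, kap; split => // v c Hvc.
  by apply: (H v c) => //; rewrite ltn_mod.
elim: j => [|j [V [C [kap [k0 IH]]]]]; first by exists 0%N, 0%N, 1.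
have [[v0 [c0 [vj Z0]]]|no] :=
  pselect (exists v c, (v %% L.+1)%N = j /\ 0 < Z w v c); last first.
  exists V, C, kap; split => // v c; rewrite ltnS leq_eqVlt => /orP[/eqP vj Zvc|].
    by exfalso; apply: no; exists v, c.
  exact: IH.
exists (maxn V v0), (maxn C c0), (Num.min kap (Z w v0 c0)).
split; first by rewrite lt_min k0 Z0.
move=> v c; rewrite ltnS leq_eqVlt => /orP[/eqP vj' Zvc|vlt Zvc].
  exists v0, c0; split; rewrite ?leq_maxr ?ge_min ?lexx ?orbT//.
  by rewrite vj vj'.
have [v' [c' [? ? ? ?]]] := IH _ _ vlt Zvc.
by exists v', c'; split; rewrite ?leq_max ?ge_min //; apply/orP; left.
Qed.

Lemma horner_wpoly1 {R : realType} (w : nat -> R) (K : nat) :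
  (wpoly w K).[1] = series w K.
Proof.
rewrite horner_poly /series /= big_mkord; apply: eq_bigr => i _.
by rewrite expr1n mulr1.
Qed.

Lemma horner_deriv_wpoly1 {R : realType} (w : nat -> R) (K : nat) :
  (wpoly w K)^`().[1] = series (fun k => k%:R * w k) K.
Proof.
rewrite /wpoly poly_def /series /= big_mkord raddf_sum horner_sum.
apply: eq_bigr => i _.
by rewrite /= derivZ derivXn hornerZ hornerMn hornerXn expr1n mulrC.
Qed.

(** The boxes are split into [n1] typical ones, [c] that repair the residue, [q] of value [L], and
    empty ones. As all weights are at most 1, the last two exponents may be raised to [r]. *)
Lemma Z_split_lower {R : realType} (p : nat -> R) (L n1 r m1 v c q : nat) :
  (forall k, 0 <= p k <= 1) -> (c + q <= r)%N ->
  Z p m1 n1 * Z p v c * (p L ^+ r * p 0%N ^+ r) <=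
  Z p (m1 + v + L * q) (n1 + r).
Proof.
move=> p01 cqr; have p0 k : 0 <= p k by case/andP: (p01 k).
have p1 k : p k <= 1 by case/andP: (p01 k).
have -> : (m1 + v + L * q = m1 + v + (L * q + 0 * (r - (c + q))))%N by lia.
have -> : (n1 + r = n1 + c + (q + (r - (c + q))))%N by lia.
apply: le_trans (Z_supermul p _ _ _ _ p0).
apply: ler_pM => //; rewrite ?mulr_ge0 ?Z_ge0 ?exprn_ge0//.
  exact: Z_supermul.
apply: le_trans (Z_supermul p _ _ _ _ p0).
apply: ler_pM => //; rewrite ?exprn_ge0//.
  by apply: le_trans (Z_const p L q p0); apply: ler_wiXn2l => //; lia.
by apply: le_trans (Z_const p 0 _ p0); apply: ler_wiXn2l => //; lia.
Qed.

(** Modulo [L.+1] the factor [L] is -1, so [v] is congruent to [m - m1]. *)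
Lemma residue_quotient (L m m1 v : nat) :
  (m1 + v <= m)%N -> v = m + L * m1 %[mod L.+1] ->
  exists q, m = (m1 + v + L.+1 * q)%N.
Proof.
move=> le_m ev.
have : m == m1 + v %[mod L.+1].
  rewrite -(modnDmr m1 v) ev modnDmr addnCA -mulSn addnC mulnC modnMDl.
  by [].
rewrite eqn_mod_dvd// => /dvdnP[q Hq]; exists q; lia.
Qed.

Lemma leq_mul_succ (a b c : nat) : (b <= c)%N -> ((a * b).+1 <= a.+1 * c.+1)%N.
Proof.
move=> bc; rewrite mulSn mulnS addSn ltnS.
by rewrite addnCA (leq_trans _ (leq_addl _ _))// (leq_trans _ (leq_addl _ _))// leq_mul2l bc orbT.
Qed.

(** Three factors [E] come from [z1], [u] and [v]; the fourth pays for the remaining constant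
    [kap * a * b / X]. *)
Lemma four_factor_bound {R : realType} (X E kap a b z1 z2 u v : R) :
  0 < X -> 0 < E -> 0 < kap -> 0 < a -> 0 < b -> X / (kap * a * b) <= E^-1 ->
  E / X <= z1 -> kap <= z2 -> E * a <= u -> E * b <= v ->
  E ^+ 4 <= z1 * z2 * (u * v).
Proof.
move=> X0 E0 k0 a0 b0 XE Ez kz au bv.
apply: (@le_trans _ _ (E / X * kap * ((E * a) * (E * b)))); last first.
  apply: ler_pM; rewrite ?mulr_ge0 ?invr_ge0 ?(ltW X0) ?(ltW E0) ?(ltW k0) ?(ltW a0) ?(ltW b0)//.
    by apply: ler_pM; rewrite ?mulr_ge0 ?invr_ge0 ?(ltW X0) ?(ltW E0) ?(ltW k0).
  by apply: ler_pM; rewrite ?mulr_ge0 ?(ltW E0) ?(ltW a0) ?(ltW b0).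
have EX : E <= kap * a * b / X.
  rewrite ler_pdivlMr// mulrC -ler_pdivlMr//.
  by move: XE; rewrite ler_pdivrMr ?mulr_gt0// mulrC.
have := ler_wpM2l (ltW (mulr_gt0 (mulr_gt0 E0 E0) E0)) EX.
move=> HH; have -> : E ^+ 4 = E * E * E * E by ring.
apply: (le_trans HH); rewrite le_eqVlt; apply/orP; left; apply/eqP; ring.
Qed.

(** The exponent [r] exceeds [d * y] by at most 1; that rounding costs the extra factor [x] on the
    left. *)
Lemma expR_mul_le_exp {R : realType} (x e d y : R) (r : nat) :
  0 <= y -> 0 < x <= 1 -> - (d * ln x) <= e -> r%:R <= d * y + 1 ->
  expR (- (e * y)) * x <= x ^+ r.
Proof.
move=> y0 /andP[x0 x1] lx ry.
have -> : expR (- (e * y)) * x = expR (- (e * y) + ln x).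
  by rewrite expRD lnK.
have -> : x ^+ r = expR (ln x * r%:R) by rewrite expRM_natr lnK.
rewrite ler_expR.
have lk : ln x <= 0 by rewrite -ler_expR expR0 lnK.
have := ler_wpM2r y0 lx.
have := ler_wnM2l lk ry; lra.
Qed.

(* The sum of [n - r] typical boxes falls short of [m] by a multiple of [n];
   the [r] remaining boxes supply the missing amount by repeating one value [L]
   of not too small probability, after a bounded number of boxes has adjusted
   the residue modulo [L]. *)
Lemma Z_subexponential {R : realType} (p : nat -> R) (m : nat -> nat) (lam mu : R) :
  (forall k, 0 <= p k <= 1) -> 0 < p 0%N ->
  series p @ \oo --> (1 : R) ->
  series (fun k => k%:R * p k) @ \oo --> mu ->
  (fun n => (m n)%:R / n%:R : R) @ \oo --> lam ->
  0 <= mu -> mu <= lam -> 0 < lam ->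
  (forall e, 0 < e -> exists (L : nat) (d : R),
    [/\ 0 < d, d < e, lam - (1 - d) * mu < d * L%:R, 0 < p L &
        - (d * ln (p L)) <= e]) ->
  forall eps, 0 < eps -> exists N : nat, forall n : nat, (N <= n)%N ->
    0 < Z p (m n) n -> expR (- (eps * n%:R)) <= Z p (m n) n.
Proof.
move=> p01 p0_gt0 cvp cvkp cvm mu0 mulam lam0 H eps eps0.
have p0 k : 0 <= p k by case/andP: (p01 k).
(* The lower bound will be a product of four factors [expR (- (e * n))], as in
   [four_factor_bound]. *)
pose e := eps / 4; have e0 : 0 < e by rewrite divr_gt0.
have epsE : 4 * e = eps by rewrite /e mulrC divfK.
have a0 : 0 < 1 + `|ln (p 0%N)| by rewrite ltr_wpDr.
(* Taking [d < e'] keeps the cost of the values [L] and 0 in the reserve boxes at most [e] per box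
   overall, and keeps [d] below 1/2. *)
pose e' := Num.min e (Num.min (e / (1 + `|ln (p 0%N)|)) 2^-1).
have e'0 : 0 < e' by rewrite !lt_min e0 divr_gt0//= invr_gt0.
(* [L = 0] cannot supply a positive missing amount. From here on the repeated value is [L.+1], which
   is also the modulus. *)
have [[|L] [d [d0]]] := H e' e'0.
  rewrite mulr0 => _ D0 _ _; exfalso; nra.
(* [D * n] is about the amount still missing after [(1 - d) n] typical boxes. *)
set D := lam - _; rewrite !lt_min => /andP[_ /andP[de d2]] DL pL lpL.
have {}lpL : - (d * ln (p L.+1)) <= e by apply: le_trans lpL _; rewrite ge_min lexx.
have lp0 : - (d * ln (p 0%N)) <= e.
  move: de; rewrite ltr_pdivlMr// => de.
  have := ler_norm (- ln (p 0%N)); rewrite normrN => Hn; nra.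
have D0 : 0 < D by rewrite /D; nra.
(* Tolerance for every error term: several errors [eta * n] still leave the missing amount positive
   and below the capacity [d * L.+1 * n] of the reserve. *)
pose eta := Num.min (D / 4) ((d * L.+1%:R - D) / 4).
have eta0 : 0 < eta by rewrite lt_min !divr_gt0// subr_gt0.
have eta1 : eta <= D / 4 by rewrite ge_min lexx.
have eta2 : eta <= (d * L.+1%:R - D) / 4 by rewrite ge_min lexx orbT.
(* A truncation of [p] that loses at most a factor [expR (- e)] of mass and whose normalised mean is
   within [eta] of [mu]. *)
have [K [K0 K1 K2]] : exists K : nat, [/\ expR (- e) < series p K,
    (mu - eta) * series p K < series (fun k => k%:R * p k) K &
    series (fun k => k%:R * p k) K < (mu + eta) * series p K].
  have c1 : (fun K => series (fun k => k%:R * p k) K - (mu - eta) * series p K)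
      @ \oo --> mu - (mu - eta) * 1 by apply: cvgB => //; apply: cvgMr.
  have c2 : (fun K => series (fun k => k%:R * p k) K - (mu + eta) * series p K)
      @ \oo --> mu - (mu + eta) * 1 by apply: cvgB => //; apply: cvgMr.
  near \oo => K; exists K; split.
  - by near: K; apply: (cvgr_gt _ cvp); rewrite -[ltRHS]expR0 ltr_expR oppr_lt0.
  - by rewrite -subr_gt0; near: K; apply: (cvgr_gt _ c1); lra.
  - by rewrite -subr_lt0; near: K; apply: (cvgr_lt _ c2); lra.
have P1 : 0 < (wpoly p K).[1].
  by rewrite horner_wpoly1; apply: lt_trans K0; apply: expR_gt0.
have [||N1 HN1] := exists_typical_sum p K (mu - eta) (mu + eta) p0 P1.
- by rewrite horner_wpoly1 horner_deriv_wpoly1.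
- by rewrite horner_wpoly1 horner_deriv_wpoly1.
have [V [C [kap [kap0 Hres]]]] := exists_residue_representatives p L.
have G0 : 0 < kap * p L.+1 * p 0%N by rewrite !mulr_gt0.
have [N2 HN2] := expR_dominates_linear e (2 * K.+1%:R / (kap * p L.+1 * p 0%N)) e0.
have [N3 _ HN3] : \forall n \near \oo, `|lam - (m n)%:R / n%:R| < eta.
  by move/cvgrPdist_lt: cvm; apply.
(* Beyond [B'], the bounded quantities (repair total, rounding of [r], repair boxes) are absorbed
   into [eta * n]. *)
have [B' B'E] : exists B', B' = (V%:R + mu + L.+1%:R * C%:R) / eta by eexists.
pose B := 1 + N1%:R * 2 + 4 + B'.
have B0 : 0 <= B'.
  rewrite B'E.
  by rewrite divr_ge0 ?addr_ge0 ?mulr_ge0// ltW.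
exists (maxn (Num.truncn B).+1 (maxn N2 N3)) => n.
rewrite !geq_max => /and3P[Bn /HN2 {}HN2 /HN3 /= {}HN3] Zpos.
have {}Bn : B <= n%:R.
  by apply: le_trans (ltW (truncnS_gt _)) _; rewrite ler_nat.
have N10 : 0 <= N1%:R :> R by [].
have x4 : 4 <= n%:R :> R by rewrite /B in Bn; lra.
have x0 : 0 < n%:R :> R by lra.
have xB : V%:R + mu + L.+1%:R * C%:R <= eta * n%:R.
  by rewrite [leRHS]mulrC -ler_pdivrMr// -B'E; rewrite /B in Bn; lra.
have [mlo mhi] : (lam - eta) * n%:R <= (m n)%:R /\ (m n)%:R <= (lam + eta) * n%:R.
  move: HN3; rewrite ltr_norml => /andP[h1 h2].
  by split; [rewrite -ler_pdivlMr//|rewrite -ler_pdivrMr//]; lra.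
(* The number of reserve boxes, [d * n] up to rounding. *)
pose r := (Num.truncn (d * n%:R)).+1.
have dn0 : 0 <= d * n%:R by rewrite mulr_ge0 ?ltW.
have [r1 r2] : d * n%:R <= r%:R /\ r%:R <= d * n%:R + 1.
  have /andP[t1 t2] := truncn_itv dn0.
  by split; [exact: ltW | rewrite /r -natr1 lerD2r].
have dn2 : d * n%:R <= n%:R / 2 by rewrite mulrC ler_wpM2l// ltW.
have rn : (r <= n)%N by rewrite -(ler_nat R); lra.
pose n1 := (n - r)%N.
have n1E : n1%:R = n%:R - r%:R :> R by rewrite natrB.
have nE : n = (n1 + r)%N by rewrite subnK.
have n1N : (N1 <= n1)%N by rewrite -(ler_nat R) n1E; rewrite /B in Bn; lra.
have [m1 [m1lo m1hi Pm1]] := HN1 _ n1N.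
have Z1 : 0 < Z p m1 n1.
  have : 0 < 2 * (K * n1).+1%:R * Z p m1 n1.
    by apply: lt_le_trans Pm1; rewrite exprn_gt0.
  by rewrite pmulr_rgt0.
(* Joining one configuration of total [m n] with [L] typical ones shows that [m n + L * m1], hence
   the residue of [m n - m1] modulo [L.+1], is attainable. This is where inverses come from in the
   finite monoid of residues. *)
have Zs : 0 < Z p (m n + L * m1) (n + L * n1).
  apply: lt_le_trans (Z_supermul p _ _ _ _ p0); rewrite mulr_gt0//.
  rewrite (mulnC L m1) (mulnC L n1); apply: lt_le_trans (Z_pow p _ _ _ p0).
  by rewrite exprn_gt0.
have [v [c [vV cC vmod kapZ]]] := Hres _ _ Zs.
rewrite n1E in m1lo m1hi.
have VR : v%:R <= V%:R :> R by rewrite ler_nat.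
have CR : c%:R <= C%:R :> R by rewrite ler_nat.
have V0 : 0 <= V%:R :> R by [].
have L0 : 0 < L.+1%:R :> R by rewrite ltr0Sn.
have LC0 : 0 <= L.+1%:R * C%:R :> R by rewrite mulr_ge0.
have mur1 : mu * r%:R <= mu * (d * n%:R + 1) by rewrite ler_wpM2l.
have mur2 : mu * (d * n%:R) <= mu * r%:R by rewrite ler_wpM2l.
have etar : 0 <= eta * r%:R by rewrite mulr_ge0// ltW.
have DE : D * n%:R = lam * n%:R - mu * n%:R + mu * (d * n%:R) by rewrite /D; ring.
have etaD : eta * n%:R <= D * n%:R / 4.
  by apply: le_trans (_ : D / 4 * n%:R <= _); [rewrite ler_wpM2r// ltW|lra].
have etaDL : 4 * (eta * n%:R) <= L.+1%:R * (d * n%:R) - D * n%:R.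
  have := ler_wpM2r (ltW x0) eta2; lra.
have m1v : (m1 + v <= m n)%N.
  rewrite -(ler_nat R) natrD; nra.
have [q Eq] := residue_quotient _ _ _ _ m1v vmod.
(* After multiplication by [L.+1], this says that the missing amount and the repair boxes fit into
   the capacity of the reserve. *)
have cq : (c + q <= r)%N.
  rewrite -(ler_nat R) natrD -(ler_pM2l L0).
  have : (m n)%:R = m1%:R + v%:R + L.+1%:R * q%:R :> R by rewrite -natrM -!natrD -Eq.
  have : L.+1%:R * c%:R <= L.+1%:R * C%:R :> R by rewrite ler_wpM2l// ltW.
  have : L.+1%:R * (d * n%:R) <= L.+1%:R * r%:R by rewrite ler_wpM2l// ltW.
  have v0 : 0 <= v%:R :> R by [].
  nra.
have := Z_split_lower p L.+1 n1 r m1 v c q p01 cq.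
rewrite -Eq -nE; apply: le_trans.
have powl k : 0 < p k -> - (d * ln (p k)) <= e ->
    expR (- (e * n%:R)) * p k <= p k ^+ r.
  move=> pk lpk; apply: expR_mul_le_exp lpk r2; first exact: ltW.
  by rewrite pk; case/andP: (p01 k).
have PL : expR (- (e * n%:R)) <= (wpoly p K).[1] ^+ n1.
  apply: (@le_trans _ _ (expR (- e) ^+ n1)); last first.
    by apply: lerXn2r; rewrite ?nnegrE ?expR_ge0 ?(ltW P1)// horner_wpoly1 ltW.
  rewrite -expRM_natr ler_expR mulNr lerN2 ler_wpM2l ?(ltW e0)// ler_nat.
  by rewrite /n1 leq_subr.
have Z1l : expR (- (e * n%:R)) / (2 * (K.+1%:R * n.+1%:R)) <= Z p m1 n1.
  rewrite ler_pdivrMr ?mulr_gt0//; apply: le_trans PL _; apply: le_trans Pm1 _.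
  rewrite mulrC; apply: ler_wpM2l; first exact: ltW.
  rewrite ler_wpM2l// -natrM ler_nat; apply: leq_mul_succ.
  exact: leq_subr.
have F1 := powl _ pL lpL; have F0 := powl _ p0_gt0 lp0.
set E := expR (- (e * n%:R)) in PL Z1l F1 F0 *.
have E0 : 0 < E by apply: expR_gt0.
have -> : expR (- (eps * n%:R)) = E ^+ 4.
  by rewrite /E -expRM_natl mulrN mulrA epsE.
apply: (four_factor_bound (2 * (K.+1%:R * n.+1%:R)) E kap) F1 F0; rewrite ?mulr_gt0 ?expR_gt0//.
move: HN2; rewrite /E expRN invrK; apply: le_trans.
by rewrite [leRHS]mulrAC !mulrA.
Unshelve. all: by end_near.
Qed.

(** * Concentration of occupancy numbers *)

Definition eventually_unlikely {R : realType} (w : nat -> R) (m : nat -> nat)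
    (E : forall n, pred {ffun 'I_n -> 'I_(m n).+1}) : Prop :=
  forall delta, 0 < delta -> exists N : nat, forall n : nat, (N <= n)%N ->
    0 < Z w (m n) n -> Prob w (E n) < delta.

Lemma eventually_unlikely_sub {R : realType} (w : nat -> R) (m : nat -> nat)
    (E F : forall n, pred {ffun 'I_n -> 'I_(m n).+1}) (N : nat) :
  (forall k, 0 <= w k) ->
  (forall n (y : {ffun 'I_n -> 'I_(m n).+1}), (N <= n)%N ->
     y \in Bset (m n) n -> E n y -> F n y) ->
  eventually_unlikely w m F -> eventually_unlikely w m E.
Proof.
move=> w0 EF HF d /HF[N' HN']; exists (maxn N N') => n.
rewrite geq_max => /andP[Nn N'n] Zn; apply: le_lt_trans (HN' _ N'n Zn).
by apply: Prob_le => // y yB; apply: EF.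
Qed.

Lemma eventually_unlikely_or {R : realType} (w : nat -> R) (m : nat -> nat)
    (E F : forall n, pred {ffun 'I_n -> 'I_(m n).+1}) :
  (forall k, 0 <= w k) ->
  eventually_unlikely w m E -> eventually_unlikely w m F ->
  eventually_unlikely w m (fun n y => E n y || F n y).
Proof.
move=> w0 HE HF d d0; have d2 : 0 < d / 2 by rewrite divr_gt0.
have [N HN] := HE _ d2; have [N' HN'] := HF _ d2.
exists (maxn N N') => n; rewrite geq_max => /andP[Nn N'n] Zn.
apply: (le_lt_trans (Prob_or _ _ _ _ _ w0)).
have := HN _ Nn Zn; have := HN' _ N'n Zn; lra.
Qed.

Lemma eventually_unlikely_pred0 {R : realType} (w : nat -> R) (m : nat -> nat) :
  eventually_unlikely w m (fun n => pred0).
Proof.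
move=> d d0; exists 0%N => n _ _; rewrite /Prob big1 ?mul0r// => y.
by rewrite andbF.
Qed.

Lemma sum_reweight_le {R : realType} (p : nat -> R) (k : nat) (x : R) (M : nat) :
  (forall k, 0 <= p k) -> (forall N, \sum_(j < N) p j <= 1) -> 0 <= x ->
  \sum_(j < M) reweight p k x j <= 1 + (x - 1) * p k.
Proof.
(* The range is enlarged to include [k], so that reweighting changes the sum by exactly
   [(x - 1) * p k]. *)
move=> p0 p1 x0; pose N := maxn M k.+1.
have r0 := reweight_ge0 p k x p0 x0.
have kN : (k < N)%N by rewrite leq_max ltnSn orbT.
apply: (@le_trans _ _ (\sum_(j < N) reweight p k x j)).
  rewrite -!(big_mkord xpredT (reweight p k x)) (big_cat_nat (n := M) (m := 0) (p := N))//=; last exact: leq_maxl.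
  by rewrite lerDl sumr_ge0.
have := p1 N; rewrite (bigD1 (Ordinal kN)) //= [in X in _ -> X](bigD1 (Ordinal kN)) //=.
rewrite {1}/reweight eqxx.
rewrite [X in _ -> _ + X <= _](eq_bigr (fun i : 'I_N => p i)); first by lra.
by move=> i ik; rewrite /reweight; case: eqP => // ik'; rewrite -val_eqE /= ik' eqxx in ik.
Qed.

(* Markov's inequality for [x ^ N_k], whose mean is a ratio of partition functions. *)
Lemma Nk_tail_unlikely {R : realType} (p : nat -> R) (m : nat -> nat)
    (k : nat) (a c : R) :
  (forall k, 0 <= p k) -> (forall N, \sum_(j < N) p j <= 1) ->
  (forall eps, 0 < eps -> exists N : nat, forall n : nat, (N <= n)%N ->
    0 < Z p (m n) n -> expR (- (eps * n%:R)) <= Z p (m n) n) ->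
  c * p k < c * a ->
  eventually_unlikely p m (fun n y => c * (a * n%:R) <= c * (Nk k y)%:R).
Proof.
move=> p0 p1 Zlow ca delta delta0.
(* The generating function of a Bernoulli variable of mean [p k], the indicator that one box
   contains [k]. *)
pose g : {poly R} := (1 - p k)%:P + (p k)%:P * 'X.
have gE x : g.[x] = 1 + (x - 1) * p k by rewrite /g !hornerE; ring.
have [|s [s0]] := chernoff_tilt g a c.
  rewrite gE /g derivD derivC add0r derivM derivC mul0r add0r derivX mulr1 hornerC; lra.
rewrite !gE subrr mul0r addr0 mul1r; set x := expR (c * s) => gx.
have x0 : 0 < x by apply: expR_gt0.
have pk1 : p k <= 1.
  apply: le_trans (p1 k.+1); rewrite big_ord_recr /= lerDr.
  by apply: sumr_ge0.
pose b := expR (a * (c * s)).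
have b0 : 0 < b by apply: expR_gt0.
pose gx' := 1 + (x - 1) * p k.
have gx0 : 0 <= gx' by rewrite /gx'; have := p0 k; nra.
(* A midpoint with 1 rather than [gx' / b] itself, which keeps [th] positive so that [ln th] makes
   sense. *)
pose th := (gx' / b + 1) / 2.
have thlt : gx' / b < 1 by rewrite ltr_pdivrMr// mul1r.
have thge : 0 <= gx' / b by rewrite divr_ge0// ltW.
have th0 : 0 < th by rewrite /th; lra.
have th1 : th < 1 by rewrite /th; lra.
have gth : gx' <= th * b by rewrite -ler_pdivrMr// /th; lra.
have lth : ln th < 0 by rewrite -ltr_expR expR0 lnK.
(* The partition function in the denominator is at least [z ^+ n] with [z] the square root of [th],
   so dividing [th ^+ n] by it still leaves [z ^+ n]. *)
have [|N1 HN1] := Zlow (- ln th / 2); first lra.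
pose z := expR (ln th / 2).
have z0 : 0 <= z by apply: expR_ge0.
have z1 : z < 1 by rewrite expR_lt1; lra.
have /cvgr_lt zc : z ^+ n @[n --> \oo] --> 0 by apply: cvg_expr; rewrite ger0_norm.
have [N2 _ HN2] := zc _ delta0.
exists (maxn N1 N2) => n; rewrite geq_max => /andP[/HN1 {}HN1 /HN2 /= zn] Zn.
apply: le_lt_trans zn; have {}HN1 := HN1 Zn.
apply: le_trans (Prob_markov p k x (b ^+ n) _ _ _ p0 _ _ _) _.
- exact: ltW.
- exact: exprn_gt0.
- move=> y _ HE; rewrite /b /x -!expRM_natr ler_expR.
  have -> : a * (c * s) * n%:R = s * (c * (a * n%:R)) by ring.
  have -> : c * s * (Nk k y)%:R = s * (c * (Nk k y)%:R) by ring.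
  by rewrite ler_wpM2l// ltW.
rewrite ler_pdivrMr ?mulr_gt0 ?exprn_gt0//.
have Zg : Z (reweight p k x) (m n) n <= gx' ^+ n.
  have := Z_le_horner (reweight p k x) 1 (m n) n (reweight_ge0 p k x p0 (ltW x0)) ler01.
  rewrite expr1n mulr1 => /le_trans; apply; apply: lerXn2r.
  - rewrite nnegrE sumr_ge0// => i _; rewrite expr1n mulr1; exact: reweight_ge0 (ltW x0) _.
  - by rewrite nnegrE.
  - under eq_bigr do rewrite expr1n mulr1.
    exact: sum_reweight_le (ltW x0).
apply: (le_trans Zg); apply: (@le_trans _ _ (th ^+ n * b ^+ n)).
  rewrite -exprMn; apply: lerXn2r; rewrite ?nnegrE//.
  by apply: mulr_ge0; apply: ltW.
rewrite mulrCA mulrC ler_wpM2l ?exprn_ge0 ?(ltW b0)//.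
have -> : th ^+ n = z ^+ n * expR (- (- ln th / 2 * n%:R)).
  rewrite /z -!expRM_natr -expRD -{1}[th]lnK// -expRM_natr; congr expR; lra.
by rewrite ler_wpM2l// exprn_ge0.
Qed.

Lemma occupancy_lln {R : realType} (p : nat -> R) (m : nat -> nat) (k : nat) (eps : R) :
  (forall k, 0 <= p k) -> (forall N, \sum_(j < N) p j <= 1) ->
  (forall eps, 0 < eps -> exists N : nat, forall n : nat, (N <= n)%N ->
    0 < Z p (m n) n -> expR (- (eps * n%:R)) <= Z p (m n) n) ->
  0 < eps ->
  eventually_unlikely p m (fun n y => eps < `| (Nk k y)%:R / n%:R - p k |).
Proof.
move=> p0 p1 Zlow eps0.
apply: (@eventually_unlikely_sub _ _ _ _ (fun n y =>
   (1 * ((p k + eps) * n%:R) <= 1 * (Nk k y)%:R) ||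
   (-1 * ((p k - eps) * n%:R) <= -1 * (Nk k y)%:R)) 1%N p0); last first.
  by apply: eventually_unlikely_or => //; apply: Nk_tail_unlikely => //; lra.
move=> n y n1 _; have n0 : 0 < n%:R :> R by rewrite ltr0n.
rewrite !mul1r !mulN1r !lerN2 => H.
apply/orP; have [h|h] := leP (p k) ((Nk k y)%:R / n%:R); [left|right].
  by move: H; rewrite -ler_pdivlMr// ger0_norm; lra.
by move: H; rewrite -ler_pdivrMr// ltr0_norm; lra.
Qed.

(** * Concentration at the empty box *)

(** Reweighting adds the monomial [((x - 1) * w k) *: 'X^k] to the polynomial. In the binomial
    expansion [j] boxes are given to this monomial and the other [n - j] share what remains of
    [m]. *)
Lemma Z_reweight_expand {R : realType} (w : nat -> R) (k : nat) (x : R) (m n : nat) :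
  Z (reweight w k x) m n = \sum_(j < n.+1)
    ((if (m < k * j)%N then 0 else Z w (m - k * j) (n - j)) *
      ((x - 1) * w k) ^+ j *+ 'C(n, j)).
Proof.
pose N := (maxn m k).+1.
have mN : (m < N)%N by rewrite ltnS leq_maxl.
have kN : (k < N)%N by rewrite ltnS leq_maxr.
have wE : wpoly (reweight w k x) N = wpoly w N + ((x - 1) * w k) *: 'X^k.
  apply/polyP => i; rewrite coefD coefZ coefXn !coef_poly /reweight.
  case: eqP => [->|_]; first by rewrite kN mulr1; ring.
  by rewrite mulr0 addr0.
rewrite (Z_coef _ N)// wE exprDn coef_sum; apply: eq_bigr => j _.
rewrite coefMn exprZn -exprM -scalerAr coefZ coefMXn mulrC.
case: ifP => // mkj; rewrite (Z_coef _ N)//.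
exact: leq_ltn_trans (leq_subr _ _) mN.
Qed.

(* With [L] of huge weight, [k] boxes of value [L] and [L - k] empty boxes
   outweigh [L] boxes of value [k]. *)
Lemma Z_diagonal_lower {R : realType} (w : nat -> R) (k : nat) (A : R) :
  (forall j, 0 <= w j) -> 0 < w 0%N -> (0 < k)%N -> 0 < w k -> 0 < A ->
  (forall (B : R) (L0 : nat), 0 < B -> exists L, (L0 <= L)%N /\ B ^+ L <= w L) ->
  exists c, 0 < c /\ forall j, c * A ^+ j <= Z w (k * j) j.
Proof.
move=> w0 w00 k0 wk A0 grow.
(* With [A1 >= 1 >= b], the powers below can be compared whatever the sizes of [A] and [w 0]. *)
pose A1 := Num.max A 1; pose b := Num.min (w 0%N) 1.
have b0 : 0 < b by rewrite lt_min w00 ltr01.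
have b1 : b <= 1 by rewrite ge_min lexx orbT.
have bw : b <= w 0%N by rewrite ge_min lexx.
have A11 : 1 <= A1 by rewrite le_max lexx orbT.
have AA1 : A <= A1 by rewrite le_max lexx.
have Ab1 : 1 <= A1 / b by rewrite ler_pdivlMr// mul1r (le_trans b1).
have Ab0 : 0 < A1 / b by apply: lt_le_trans Ab1.
(* Then [w L ^+ k] is at least (A1/b)^L, and the [L - k] empty boxes cost at most a factor b^L;
   together they leave A1^L >= A^L. *)
have [L [kL wL]] := grow _ k.+1 Ab0.
have L0 : (0 < L)%N by apply: leq_trans kL.
have wL1 : 1 <= w L by apply: le_trans wL; apply: exprn_ege1.
have ZL : A ^+ L <= Z w (k * L) L.
  have -> : Z w (k * L) L = Z w (L * k + 0 * (L - k)) (k + (L - k)).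
    by rewrite mul0n addn0 mulnC subnKC// ltnW.
  apply: le_trans (Z_supermul w _ _ _ _ w0).
  apply: (@le_trans _ _ (w L ^+ k * w 0%N ^+ (L - k))); last first.
    by apply: ler_pM; rewrite ?exprn_ge0//; apply: Z_const.
  apply: (@le_trans _ _ ((A1 / b) ^+ L * b ^+ L)).
    by rewrite -exprMn divfK ?gt_eqF//; apply: lerXn2r; rewrite ?nnegrE ?(ltW A0)//; lra.
  apply: ler_pM; rewrite ?exprn_ge0 ?(ltW Ab0) ?(ltW b0)//.
    by apply: (le_trans wL); apply: ler_eXnr.
  apply: (@le_trans _ _ (b ^+ (L - k))).
    by apply: ler_wiXn2l; rewrite ?(ltW b0) ?leq_subr.
  by apply: lerXn2r; rewrite ?nnegrE ?(ltW b0).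
(* Blocks of [L] boxes leave a remainder of fewer than [L] boxes, each of weight [w k >= c * A];
   this costs at most [c ^+ L]. *)
pose c := Num.min 1 (w k / A).
have c0 : 0 < c by rewrite lt_min ltr01 divr_gt0.
have c1 : c <= 1 by rewrite ge_min lexx.
have cw : c * A <= w k by rewrite -ler_pdivlMr// ge_min lexx orbT.
exists (c ^+ L); split => [|j]; first exact: exprn_gt0.
pose q := (j %/ L)%N; pose s := (j %% L)%N.
have jE : (j = L * q + s)%N by rewrite mulnC -divn_eq.
have sL : (s <= L)%N by rewrite ltnW// ltn_mod.
have -> : (k * j = k * L * q + k * s)%N by rewrite {1}jE mulnDr mulnA.
rewrite {1 2}jE; apply: le_trans (Z_supermul w _ _ _ _ w0).
apply: (@le_trans _ _ ((A ^+ L) ^+ q * (c * A) ^+ s)); last first.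
  apply: ler_pM; rewrite ?exprn_ge0 ?mulr_ge0 ?(ltW A0) ?(ltW c0)//.
    apply: le_trans (Z_pow w _ _ q w0); apply: lerXn2r => //.
      by rewrite nnegrE exprn_ge0// ltW.
    by rewrite nnegrE Z_ge0.
  apply: le_trans (Z_const w k s w0); apply: lerXn2r => //; rewrite nnegrE//.
  by rewrite mulr_ge0 ?(ltW A0) ?(ltW c0).
have -> : (A ^+ L) ^+ q * (c * A) ^+ s = c ^+ s * A ^+ (L * q + s).
  by rewrite -exprM exprMn exprD mulrCA.
rewrite ler_wpM2r ?exprn_ge0 ?(ltW A0)//.
by apply: ler_wiXn2l; rewrite ?(ltW c0).
Qed.

(** In the [j]-th term of the expansion, supermultiplicativity with [Z w (k * j) j] bounds
    [Z w (m - k * j) (n - j)] by [Z w m n / (c * A ^+ j)]; the binomial theorem then sums the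
    terms. *)
Lemma Z_reweight_le {R : realType} (w : nat -> R) (k : nat) (x c A : R) (m n : nat) :
  (forall j, 0 <= w j) -> 1 <= x -> 0 < c -> 0 < A ->
  (forall j, c * A ^+ j <= Z w (k * j) j) ->
  Z (reweight w k x) m n <= (1 + (x - 1) * w k / A) ^+ n / c * Z w m n.
Proof.
move=> w0 x1 c0 A0 HZ; rewrite Z_reweight_expand.
have y0 : 0 <= (x - 1) * w k by rewrite mulr_ge0// subr_ge0.
have -> : (1 + (x - 1) * w k / A) ^+ n / c * Z w m n =
    \sum_(j < n.+1) ((x - 1) * w k) ^+ j * (A ^- j / c * Z w m n) *+ 'C(n, j).
  rewrite [1 + _]addrC exprD1n !mulr_suml; apply: eq_bigr => j _.
  by rewrite expr_div_n !mulrnAl !mulrA.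
apply: ler_sum => j _; apply: ler_wMn2r; rewrite mulrC.
apply: ler_wpM2l; first exact: exprn_ge0.
rewrite -invfM mulrC ler_pdivlMr ?mulr_gt0 ?exprn_gt0//.
case: ltnP => [_|kjm]; first by rewrite mul0r Z_ge0.
have jn : (j <= n)%N by rewrite -ltnS.
apply: (@le_trans _ _ (Z w (k * j) j * Z w (m - k * j) (n - j))).
  by rewrite mulrC ler_wpM2r ?Z_ge0// mulrC.
by apply: le_trans (Z_supermul w _ _ _ _ w0) _; rewrite !subnKC.
Qed.

(** The expectation of [expR (Nk k y)] is at most [expR (eps / 2 * n) / c], so Markov's inequality
    at the level [expR (eps * n)] gains [expR (- (eps / 2 * n))]. *)
Lemma Nk_unlikely_of_growth {R : realType} (w : nat -> R) (m : nat -> nat)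
    (k : nat) (eps : R) :
  (forall j, 0 <= w j) -> 0 < w 0%N -> (0 < k)%N ->
  (forall (B : R) (L0 : nat), 0 < B -> exists L, (L0 <= L)%N /\ B ^+ L <= w L) ->
  0 < eps -> eventually_unlikely w m (fun n y => eps * n%:R <= (Nk k y)%:R).
Proof.
move=> w0 w00 k0 grow eps0 delta delta0.
pose x := expR (1 : R).
have x1 : 1 <= x by rewrite -[leLHS]expR0 ler_expR.
have [c [c0 Hc]] : exists c, 0 < c /\ forall n, 
    Z (reweight w k x) (m n) n <= expR (eps / 2 * n%:R) / c * Z w (m n) n.
  have e20 : 0 < eps / 2 by rewrite divr_gt0.
  have [wk|wk] := eqVneq (w k) 0.
    exists 1; split => // n; rewrite (_ : reweight w k x = w); last first.
      by apply/funext => j; rewrite /reweight; case: eqP => // ->; rewrite wk mulr0.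
    by rewrite divr1 ler_peMl ?Z_ge0// -[leLHS]expR0 ler_expR mulr_ge0// ltW.
  have {}wk : 0 < w k by rewrite lt_neqAle eq_sym wk w0.
  (* This [A] makes [(x - 1) * w k / A] at most [eps / 2]. *)
  have A0 : 0 < x * w k / (eps / 2) by rewrite divr_gt0// mulr_gt0// (lt_le_trans ltr01).
  have [c [c0 Hc]] := Z_diagonal_lower w k _ w0 w00 k0 wk A0 grow.
  exists c; split => // n.
  apply: le_trans (Z_reweight_le w k x c _ (m n) n w0 x1 c0 A0 Hc) _.
  rewrite ler_wpM2r ?Z_ge0// ler_wpM2r ?invr_ge0 ?(ltW c0)// expRM_natr.
  have xw : 0 < x * w k by rewrite mulr_gt0// (lt_le_trans ltr01).
  have h0 : 0 <= (x - 1) * w k / (x * w k / (eps / 2)).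
    by apply: divr_ge0; [apply: mulr_ge0; rewrite ?subr_ge0|exact: ltW].
  apply: lerXn2r; rewrite ?nnegrE ?expR_ge0 ?addr_ge0//.
  apply: le_trans (expR_ge1Dx _); rewrite lerD2l invf_div mulrA ler_pdivrMr//.
  by rewrite mulrC ler_wpM2l ?(ltW e20)// ler_wpM2r//; lra.
pose z := expR (- (eps / 2)).
have z0 : 0 <= z by apply: expR_ge0.
have z1 : z < 1 by rewrite expR_lt1; lra.
have /cvgr_lt zc : z ^+ n @[n --> \oo] --> 0 by apply: cvg_expr; rewrite ger0_norm.
have [|N _ HN] := zc (delta * c); first by rewrite mulr_gt0.
exists N => n /HN /= zn Zn.
apply: (@le_lt_trans _ _ (z ^+ n / c)); last by rewrite ltr_pdivrMr.
apply: le_trans (Prob_markov w k x (expR (eps * n%:R)) _ _ _ w0 _ (expR_gt0 _) _) _.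
- exact: le_trans x1.
- by move=> y _ HE; rewrite /x -expRM_natr mul1r ler_expR.
rewrite ler_pdivrMr ?mulr_gt0 ?expR_gt0//; apply: (le_trans (Hc n)).
rewrite [leRHS]mulrA; apply: ler_wpM2r; first exact: ltW.
rewrite [leRHS]mulrAC; apply: ler_wpM2r; first by rewrite invr_ge0 ltW.
rewrite /z -expRM_natr -expRD ler_expR; lra.
Qed.

(** Markov's inequality by counting: a box with more than [K] balls uses at least [K.+1] of the [m]
    balls. *)
Lemma box_count_bound (K m n : nat) (y : {ffun 'I_n -> 'I_m.+1}) : y \in Bset m n ->
  (n * K.+1 <= K.+1 * (Nk 0 y + \sum_(1 <= k < K.+1) Nk k y) + m)%N.
Proof.
rewrite inE => /eqP yB; rewrite -[X in (_ <= _ + X)%N]yB.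
have -> : (Nk 0 y + \sum_(1 <= k < K.+1) Nk k y = \sum_(0 <= k < K.+1) Nk k y)%N.
  by rewrite [RHS]big_ltn.
under eq_big_nat do rewrite NkE.
rewrite exchange_big /= big_distrr -big_split /=.
rewrite -[X in (X * _)%N]card_ord -sum_nat_const; apply: leq_sum => i _.
have [yK|yK] := leqP (y i) K; last by apply: leq_trans yK (leq_addl _ _).
rewrite (leq_trans _ (leq_addr _ _))// leq_pmulr//.
have yK' : (y i < K.+1)%N by [].
by rewrite big_mkord (bigD1 (Ordinal yK')) //= eqxx.
Qed.

Lemma sum_Nk_unlikely {R : realType} (w : nat -> R) (m : nat -> nat) (K : nat) :
  (forall j, 0 <= w j) ->
  (forall (k : nat) (eps : R), (0 < k)%N -> 0 < eps ->
    eventually_unlikely w m (fun n y => eps * n%:R <= (Nk k y)%:R)) ->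
  forall eps : R, 0 < eps ->
    eventually_unlikely w m
      (fun n y => eps * n%:R <= (\sum_(1 <= k < K.+1) Nk k y)%:R).
Proof.
move=> w0 H; elim: K => [|K IH] eps eps0.
  apply: (@eventually_unlikely_sub _ _ _ _ (fun=> pred0) 1%N w0).
    move=> n y n1 _; rewrite big_geq// => Hn.
    by move: Hn; rewrite leNgt mulr_gt0// ltr0n.
  exact: eventually_unlikely_pred0.
have e2 : 0 < eps / 2 by rewrite divr_gt0.
apply: (@eventually_unlikely_sub _ _ _ _ (fun n y =>
   (eps / 2 * n%:R <= (\sum_(1 <= k < K.+1) Nk k y)%:R) ||
   (eps / 2 * n%:R <= (Nk K.+1 y)%:R)) 0%N w0); last first.
  by apply: eventually_unlikely_or => //; [exact: IH|exact: H].
move=> n y _ _; rewrite big_nat_recr//= natrD => Hn.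
by apply/orP; have [h|h] := leP (eps / 2 * n%:R) (Nk K.+1 y)%:R; [right|left; lra].
Qed.

(** Few boxes hold more than [K] balls because the total is O(n), and few hold between 1 and [K] by
    hypothesis; the others are empty. *)
Lemma occupancy_point_mass {R : realType} (w : nat -> R) (m : nat -> nat)
    (lam : R) (k : nat) (eps : R) :
  (forall j, 0 <= w j) -> (fun n => (m n)%:R / n%:R : R) @ \oo --> lam ->
  (forall (k : nat) (eps : R), (0 < k)%N -> 0 < eps ->
    eventually_unlikely w m (fun n y => eps * n%:R <= (Nk k y)%:R)) ->
  0 < eps ->
  eventually_unlikely w m (fun n y => eps < `| (Nk k y)%:R / n%:R - (k == 0%N)%:R |).
Proof.
move=> w0 cvm H eps0; case: k => [|k]; last first.
  apply: (@eventually_unlikely_sub _ _ _ _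
    (fun n y => eps * n%:R <= (Nk k.+1 y)%:R) 1%N w0) (H _ _ _ eps0) => //.
  move=> n y n1 _; have n0 : 0 < n%:R :> R by rewrite ltr0n.
  by rewrite subr0 ger0_norm// -ler_pdivlMr// => /ltW.
have [N1 _ HN1] : \forall n \near \oo, (m n)%:R / n%:R < lam + 1.
  by move/cvgr_lt: cvm; apply; rewrite ltrDl.
(* So that at most [eps / 2 * n] boxes hold more than [K] balls once [m < (lam + 1) n]. *)
pose K := Num.truncn (2 * (`|lam| + 1) / eps).
have KE : 2 * (`|lam| + 1) <= K.+1%:R * eps.
  by rewrite -ler_pdivrMr// ltW// truncnS_gt.
have e2 : 0 < eps / 2 by rewrite divr_gt0.
apply: (@eventually_unlikely_sub _ _ _ _ (fun n y =>
   eps / 2 * n%:R <= (\sum_(1 <= k < K.+1) Nk k y)%:R) (maxn 1 N1) w0); last first.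
  exact: sum_Nk_unlikely.
move=> n y; rewrite geq_max => /andP[n1 /HN1 /= mn] yB.
have n0 : 0 < n%:R :> R by rewrite ltr0n.
have N0n : (Nk 0 y)%:R / n%:R <= 1 :> R.
  rewrite ler_pdivrMr// mul1r ler_nat NkE -[leqRHS]card_ord -sum1_card.
  by apply: leq_sum => i _; case: eqP.
rewrite ler0_norm ?subr_le0// => He.
have {}He : (Nk 0 y)%:R <= (1 - eps) * n%:R.
  by rewrite -ler_pdivrMr//; lra.
move: mn; rewrite ltr_pdivrMr// => mn.
have := box_count_bound K _ _ _ yB.
rewrite -(ler_nat R) natrD !natrM natrD.
set S := (\sum_(1 <= k < K.+1) _)%N => HB.
have K0 : 0 < K.+1%:R :> R by rewrite ltr0Sn.
have h1 : K.+1%:R * (Nk 0 y)%:R <= K.+1%:R * ((1 - eps) * n%:R) by rewrite ler_wpM2l// ltW.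
have h2 : 2 * (`|lam| + 1) * n%:R <= K.+1%:R * eps * n%:R by rewrite ler_wpM2r// ltW.
have h3 : lam * n%:R <= `|lam| * n%:R by rewrite ler_wpM2r ?ler_norm// ltW.
rewrite -(ler_pM2l K0); lra.
Qed.

Lemma Nk_unlikely_sparse {R : realType} (w : nat -> R) (m : nat -> nat) (k : nat) (eps : R) :
  (forall j, 0 <= w j) -> (fun n => (m n)%:R / n%:R : R) @ \oo --> (0 : R) ->
  (0 < k)%N -> 0 < eps ->
  eventually_unlikely w m (fun n y => eps * n%:R <= (Nk k y)%:R).
Proof.
move=> w0 cvm k0 eps0.
have [N1 _ HN1] : \forall n \near \oo, (m n)%:R / n%:R < eps.
  by move/cvgr_lt: cvm; apply.
apply: (@eventually_unlikely_sub _ _ _ _ (fun=> pred0) (maxn 1 N1) w0); last first.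
  exact: eventually_unlikely_pred0.
move=> n y; rewrite geq_max => /andP[n1 /HN1 /= mn] yB.
have n0 : 0 < n%:R :> R by rewrite ltr0n.
move: mn; rewrite ltr_pdivrMr// => mn; rewrite leNgt => /negP[].
apply: le_lt_trans mn; rewrite ler_nat NkE.
move: yB; rewrite inE => /eqP yB; rewrite -[leqRHS]yB; apply: leq_sum => i _.
by case: eqP => // ->.
Qed.

(** * The generating function and the mean of the tilted law *)

(** [PhiE (moment w) t] is t Phi'(t), the numerator of Psi. Being again a series with nonnegative
    coefficients, it falls under the same lemmas as Phi, and so does its iterate. *)
Definition moment {R : realType} (w : nat -> R) : nat -> R := fun k => k%:R * w k.

Lemma moment_ge0 {R : realType} (w : nat -> R) :
  (forall k, 0 <= w k) -> forall k, 0 <= moment w k.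
Proof. by move=> w0 k; rewrite mulr_ge0. Qed.

Lemma PhiE_of_cvg {R : realType} (u : nat -> R) (t s : R) :
  pseries u t @ \oo --> s -> PhiE u t = s%:E.
Proof.
move=> us; have <- : limn (pseries u t) = s by apply/cvg_lim.
rewrite -EFin_lim; last by apply/cvg_ex; exists s.
by apply: congr_lim; apply/funext => n /=; rewrite sumEFin.
Qed.

Lemma pseries_cvg_fine {R : realType} (u : nat -> R) (t : R) :
  (forall k, 0 <= u k) -> 0 <= t -> (PhiE u t < +oo)%E ->
  pseries u t @ \oo --> fine (PhiE u t).
Proof.
move=> u0 t0 fin; have cu : cvgn (pseries u t).
  by apply: nnseries_is_cvg => // i; rewrite mulr_ge0 ?exprn_ge0.
by rewrite (PhiE_of_cvg _ _ _ cu).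
Qed.

Lemma PhiE_ge_partial {R : realType} (u : nat -> R) (t : R) (n : nat) :
  (forall k, 0 <= u k) -> 0 <= t ->
  ((\sum_(i < n) u i * t ^+ i)%:E <= PhiE u t)%E.
Proof.
move=> u0 t0; rewrite -(big_mkord xpredT (fun i => u i * t ^+ i)) -sumEFin.
by apply: nneseries_lim_ge => i _ _; rewrite lee_fin mulr_ge0 ?exprn_ge0.
Qed.

Lemma PhiE_le_bound {R : realType} (u : nat -> R) (t C : R) :
  (forall k, 0 <= u k) -> 0 <= t ->
  (forall n, \sum_(i < n) u i * t ^+ i <= C) -> (PhiE u t <= C%:E)%E.
Proof.
move=> u0 t0 H; apply: lime_le.
  by apply: is_cvg_nneseries => i _ _; rewrite lee_fin mulr_ge0 ?exprn_ge0.
by apply: nearW => n; rewrite sumEFin lee_fin big_mkord.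
Qed.

Lemma PhiE_ge0 {R : realType} (u : nat -> R) (t : R) :
  (forall k, 0 <= u k) -> 0 <= t -> (0 <= PhiE u t)%E.
Proof. by move=> u0 t0; have := PhiE_ge_partial u t 0 u0 t0; rewrite big_ord0. Qed.

Lemma PhiE_le_mono {R : realType} (u : nat -> R) (s t : R) :
  (forall k, 0 <= u k) -> 0 <= s -> s <= t -> (PhiE u s <= PhiE u t)%E.
Proof.
move=> u0 s0 st; apply: lee_nneseries => i _; first by move=> _; rewrite lee_fin mulr_ge0 ?exprn_ge0.
rewrite lee_fin ler_wpM2l// lerXn2r// nnegrE//; exact: le_trans st.
Qed.

Lemma PhiE_fineK {R : realType} (u : nat -> R) (t : R) :
  (forall k, 0 <= u k) -> 0 <= t -> (PhiE u t < +oo)%E ->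
  (fine (PhiE u t))%:E = PhiE u t.
Proof. by move=> u0 t0 fin; rewrite fineK// ge0_fin_numE// PhiE_ge0. Qed.

Lemma fine_PhiE_gt0 {R : realType} (w : nat -> R) (t : R) :
  (forall k, 0 <= w k) -> 0 < w 0%N -> 0 <= t -> (PhiE w t < +oo)%E ->
  0 < fine (PhiE w t).
Proof.
move=> w0 w00 t0 fin; have := PhiE_ge_partial w t 1 w0 t0.
rewrite big_ord1 expr0 mulr1 -(PhiE_fineK w t)// lee_fin; exact: lt_le_trans.
Qed.

(** Each of the [k] copies of [x ^+ k] is at most [x ^+ i] with [i < k], and the geometric sum is
    bounded. *)
Lemma natr_exp_bounded {R : realType} (x : R) (k : nat) : 0 <= x -> x < 1 ->
  k%:R * x ^+ k <= (1 - x)^-1.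
Proof.
move=> x0 x1; have d0 : 0 < 1 - x by rewrite subr_gt0.
rewrite -[leRHS]mul1r ler_pdivlMr//.
have : k%:R * x ^+ k <= \sum_(i < k) x ^+ i.
  rewrite -[k in k%:R]card_ord mulr_natl -sumr_const; apply: ler_sum => i _.
  by apply: ler_wiXn2l; [|exact: ltW|exact: ltnW].
move=> /(ler_wpM2r (ltW d0)) /le_trans; apply.
rewrite mulrC -opprB mulNr -subrX1 opprB; have := exprn_ge0 k x0; lra.
Qed.

Lemma PhiE_moment_fin {R : realType} (u : nat -> R) (s t : R) :
  (forall k, 0 <= u k) -> 0 <= s -> s < t -> (PhiE u t < +oo)%E ->
  (PhiE (moment u) s < +oo)%E.
Proof.
move=> u0 s0 st fin; have t0 : 0 < t by apply: le_lt_trans st.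
pose C := (1 - s / t)^-1.
have st1 : s / t < 1 by rewrite ltr_pdivrMr// mul1r.
have C0 : 0 <= C by rewrite invr_ge0 subr_ge0 ltW.
apply: le_lt_trans (ltry (C * fine (PhiE u t))).
apply: PhiE_le_bound => //; first exact: moment_ge0.
move=> n; have := PhiE_ge_partial u t n u0 (ltW t0).
rewrite -(PhiE_fineK u t) ?(ltW t0)// lee_fin => /(ler_wpM2l C0); apply: le_trans.
rewrite mulr_sumr; apply: ler_sum => i _; rewrite /moment.
have -> : i%:R * u i * s ^+ i = (i%:R * (s / t) ^+ i) * (u i * t ^+ i).
  by rewrite expr_div_n mulrACA divfK ?expf_neq0 ?gt_eqF// -mulrA.
apply: ler_wpM2r; first by rewrite mulr_ge0 ?exprn_ge0// ltW.
by apply: natr_exp_bounded => //; rewrite divr_ge0// ltW.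
Qed.

Lemma pseries_diffs_ge0 {R : realType} (u : nat -> R) :
  (forall k, 0 <= u k) -> forall k, 0 <= pseries_diffs u k.
Proof. by move=> u0 k; rewrite mulr_ge0. Qed.

Lemma PhiE_diffs_fin {R : realType} (u : nat -> R) (s t : R) :
  (forall k, 0 <= u k) -> 0 < s -> s < t -> (PhiE u t < +oo)%E ->
  (PhiE (pseries_diffs u) s < +oo)%E.
Proof.
move=> u0 s0 st fin.
have m0 := moment_ge0 u u0.
have fin1 := PhiE_moment_fin u s t u0 (ltW s0) st fin.
apply: le_lt_trans (ltry (fine (PhiE (moment u) s) / s)).
apply: PhiE_le_bound (ltW s0) _; first exact: pseries_diffs_ge0.
move=> n; have := PhiE_ge_partial (moment u) s n.+1 m0 (ltW s0).
rewrite -(PhiE_fineK (moment u) s) ?(ltW s0)// lee_fin => H; rewrite ler_pdivlMr//; apply: le_trans H.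
rewrite big_ord_recl /moment mul0r mul0r add0r mulr_suml; apply: ler_sum => i _.
by rewrite -[leLHS]mulrA -exprSr.
Qed.

(* [(k - c) (x ^ k - x ^ c) >= 0] for [x = t / s > 1]. *)
Lemma tilt_strict {R : realType} (w : nat -> R) (c s t A0 A1 B0 B1 : R) (j : nat) :
  (forall k, 0 <= w k) -> 0 < s -> s < t -> 0 < w j -> j%:R != c ->
  pseries w s @ \oo --> A0 -> pseries (moment w) s @ \oo --> A1 ->
  pseries w t @ \oo --> B0 -> pseries (moment w) t @ \oo --> B1 ->
  c * A0 <= A1 -> c * B0 < B1.
Proof.
move=> w0 s0 st wj jc cA0 cA1 cB0 cB1 cA.
have t0 : 0 < t by apply: lt_trans st.
pose x := t / s; have x1 : 1 < x by rewrite ltr_pdivlMr// mul1r.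
have L0 : 0 < ln x by rewrite ln_gt0.
have x0 : 0 < x by apply: lt_trans x1.
(* The real power x^c. *)
pose e := expR (ln x * c).
(* These nonnegative terms sum to (B1 - c B0) - x^c (A1 - c A0), and the term of index [j] is
   positive. *)
pose d k := (k%:R - c) * w k * s ^+ k * (x ^+ k - e).
have xk k : x ^+ k = expR (ln x * k%:R) by rewrite expRM_natr lnK.
have dge (k : nat) : 0 <= (k%:R - c) * (x ^+ k - e).
  rewrite xk /e; have [kc|kc] := leP c k%:R.
    by rewrite mulr_ge0// subr_ge0// ler_expR ler_wpM2l// ltW.
  by rewrite mulr_le0// subr_le0 ?ler_expR ?ler_wpM2l// ltW.
have d0 k : 0 <= d k.
  have -> : d k = (w k * s ^+ k) * ((k%:R - c) * (x ^+ k - e)) by rewrite /d; ring.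
  by rewrite mulr_ge0// mulr_ge0// exprn_ge0// ltW.
have dj : 0 < d j.
  have -> : d j = (w j * s ^+ j) * ((j%:R - c) * (x ^+ j - e)) by rewrite /d; ring.
  apply: mulr_gt0; first by rewrite mulr_gt0 ?exprn_gt0.
  rewrite lt_neqAle dge andbT eq_sym mulf_neq0//.
    by rewrite subr_eq0.
  rewrite subr_eq0 xk /e; apply: contra jc => /eqP /expR_inj /(mulfI (lt0r_neq0 L0)) ->.
  by [].
have cd : series d @ \oo --> (B1 - c * B0) - e * (A1 - c * A0).
  have -> : series d = fun n => (pseries (moment w) t n - c * pseries w t n) -
       e * (pseries (moment w) s n - c * pseries w s n); last first.
    by apply: cvgB; [|apply: cvgMr]; apply: cvgB => //; apply: cvgMr.
  apply/funext => n; rewrite /pseries /series /= !mulr_sumr -!sumrB mulr_sumr -sumrB.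
  apply: eq_bigr => i _; rewrite /d /moment.
  have -> : t ^+ i = x ^+ i * s ^+ i by rewrite -exprMn divfK// gt_eqF.
  ring.
have : d j <= (B1 - c * B0) - e * (A1 - c * A0).
  have nd : nondecreasing_seq (series d).
    by apply/nondecreasing_seqP => n; rewrite /series /= big_nat_recr//= lerDl.
  have cvd : cvgn (series d) by apply/cvg_ex; eexists; exact: cd.
  have := nondecreasing_cvgn_le nd cvd j.+1.
  rewrite (cvg_lim _ cd)//; apply: le_trans.
  by rewrite /series /= big_nat_recr//= lerDr sumr_ge0.
have : 0 <= e * (A1 - c * A0) by rewrite mulr_ge0 ?expR_ge0// subr_ge0.
lra.
Qed.

Lemma PsiE_fin {R : realType} (w : nat -> R) (t : R) :
  (forall k, 0 <= w k) -> 0 <= t -> (PhiE (moment w) t < +oo)%E ->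
  PsiE w t = (fine (PhiE (moment w) t) / fine (PhiE w t))%:E.
Proof.
move=> w0 t0 fin1; rewrite /PsiE -/(PhiE (moment w) t).
by rewrite -(PhiE_fineK (moment w) t)//; exact: moment_ge0.
Qed.

Lemma PsiE_ge0 {R : realType} (w : nat -> R) (t : R) :
  (forall k, 0 <= w k) -> 0 <= t -> (0 <= PsiE w t)%E.
Proof.
move=> w0 t0; rewrite /PsiE -/(PhiE (moment w) t) mule_ge0//.
  by apply: PhiE_ge0 => //; exact: moment_ge0.
by rewrite lee_fin invr_ge0 fine_ge0// PhiE_ge0.
Qed.

Lemma PsiE_infty {R : realType} (w : nat -> R) (t : R) :
  (forall k, 0 <= w k) -> 0 < w 0%N -> 0 <= t -> (PhiE w t < +oo)%E ->
  PhiE (moment w) t = +oo%E -> PsiE w t = +oo%E.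
Proof.
move=> w0 w00 t0 fin e; rewrite /PsiE -/(PhiE (moment w) t) e gt0_mulye//.
by rewrite lte_fin invr_gt0 fine_PhiE_gt0.
Qed.

Lemma series_at0 {R : realType} (u : nat -> R) : pseries u 0 @ \oo --> u 0%N.
Proof.
rewrite -cvg_shiftS; apply: cvg_near_cst; apply: nearW => n.
rewrite /pseries /series /= big_nat_recl//= expr0 mulr1 big1 ?addr0// => i _.
by rewrite exprS mul0r mulr0.
Qed.

Lemma PhiE0 {R : realType} (u : nat -> R) : PhiE u 0 = (u 0%N)%:E.
Proof. by apply: PhiE_of_cvg; apply: series_at0. Qed.

Lemma PsiE0 {R : realType} (w : nat -> R) : PsiE w 0 = 0%E.
Proof. by rewrite /PsiE -/(PhiE (moment w) 0) PhiE0 /moment mul0r mul0e. Qed.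

(** A real threshold [c] between the two values copes with an infinite [PsiE w t]. When it is
    finite, [tilt_strict] applies with an index [j] other than [c] of positive weight. *)
Lemma PsiE_strict {R : realType} (w : nat -> R) (s t c : R) :
  (forall k, 0 <= w k) -> 0 < w 0%N -> (exists k, (1 <= k)%N /\ 0 < w k) ->
  0 <= s -> s < t -> (PhiE w t < +oo)%E ->
  (c%:E <= PsiE w s)%E -> (c%:E < PsiE w t)%E.
Proof.
move=> w0 w00 [k1 [k11 wk1]] s0 st fint cs.
have t0 : 0 < t by apply: le_lt_trans st.
have [e|] := eqVneq (PhiE (moment w) t) +oo%E.
  by rewrite PsiE_infty ?ltry// ltW.
rewrite -ltey => fint1.
have m0 := moment_ge0 w w0.
have p0 := fine_PhiE_gt0 w t w0 w00 (ltW t0) fint.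
rewrite PsiE_fin ?(ltW t0)// lte_fin ltr_pdivlMr//.
have ct := pseries_cvg_fine w t w0 (ltW t0) fint.
have ct1 := pseries_cvg_fine (moment w) t m0 (ltW t0) fint1.
(* [tilt_strict] divides by [s]; at [s = 0] the positive term of index [k1] suffices. *)
have [s_eq0|s_neq0] := eqVneq s 0.
  move: cs; rewrite s_eq0 PsiE0 lee_fin => c0.
  apply: (@le_lt_trans _ _ 0); first by rewrite mulr_le0_ge0// ltW.
  have := PhiE_ge_partial (moment w) t k1.+1 m0 (ltW t0).
  rewrite -(PhiE_fineK (moment w) t) ?(ltW t0)// lee_fin; apply: lt_le_trans.
  rewrite big_ord_recr /= ltr_wpDl//.
    by apply: sumr_ge0 => i _; rewrite mulr_ge0// exprn_ge0// ltW.
  by rewrite mulr_gt0 ?exprn_gt0// mulr_gt0// ltr0n.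
have {}s0 : 0 < s by rewrite lt_neqAle eq_sym s_neq0.
have fins : (PhiE w s < +oo)%E.
  by apply: le_lt_trans fint; apply: PhiE_le_mono => //; apply: ltW.
have fins1 := PhiE_moment_fin w s t w0 (ltW s0) st fint.
have cs0 := pseries_cvg_fine w s w0 (ltW s0) fins.
have cs1 := pseries_cvg_fine (moment w) s m0 (ltW s0) fins1.
have q0 := fine_PhiE_gt0 w s w0 w00 (ltW s0) fins.
move: cs; rewrite PsiE_fin ?(ltW s0)// lee_fin ler_pdivlMr// => cs.
have [c0|c0] := eqVneq c 0.
  apply: (tilt_strict w c s t _ _ _ _ k1 w0 s0 st wk1 _ cs0 cs1 ct ct1 cs).
  by rewrite c0 pnatr_eq0; case: (k1) k11.
by apply: (tilt_strict w c s t _ _ _ _ 0 w0 s0 st w00 _ cs0 cs1 ct ct1 cs); rewrite eq_sym.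
Qed.

Lemma PsiE_lt {R : realType} (w : nat -> R) (s t : R) :
  (forall k, 0 <= w k) -> 0 < w 0%N -> (exists k, (1 <= k)%N /\ 0 < w k) ->
  0 <= s -> s < t -> (PhiE w t < +oo)%E -> (PsiE w s < PsiE w t)%E.
Proof.
move=> w0 w00 wk s0 st fint.
have fins1 := PhiE_moment_fin w s t w0 s0 st fint.
have := PsiE_fin w s w0 s0 fins1 => e; rewrite e.
by apply: (PsiE_strict w s) => //; rewrite e.
Qed.

(** * The radius of convergence and the range of Psi *)

Lemma rho_ge0 {R : realType} (w : nat -> R) : (0 <= rho w)%E.
Proof. by apply: ereal_sup_ubound; exists 0 => //; split => //; rewrite PhiE0 ltry. Qed.

Lemma PhiE_fin_le_rho {R : realType} (w : nat -> R) (t : R) :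
  0 <= t -> (PhiE w t < +oo)%E -> (t%:E <= rho w)%E.
Proof. by move=> t0 fin; apply: ereal_sup_ubound; exists t. Qed.

Lemma lt_rho {R : realType} (w : nat -> R) (t : R) : (t%:E < rho w)%E ->
  exists s, [/\ 0 <= s, t < s & (PhiE w s < +oo)%E].
Proof. by move=> /ereal_sup_gt[_ [s [s0 fin] <-]]; rewrite lte_fin; exists s. Qed.

Lemma PhiE_fin_lt_rho {R : realType} (w : nat -> R) (t : R) :
  (forall k, 0 <= w k) -> 0 <= t -> (t%:E < rho w)%E -> (PhiE w t < +oo)%E.
Proof.
move=> w0 t0 /lt_rho[s [s0 ts fin]]; apply: le_lt_trans fin.
by apply: PhiE_le_mono => //; apply: ltW.
Qed.

Lemma PhiE_moment_lt_rho {R : realType} (w : nat -> R) (t : R) :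
  (forall k, 0 <= w k) -> 0 <= t -> (t%:E < rho w)%E ->
  (PhiE (moment w) t < +oo)%E.
Proof. by move=> w0 t0 /lt_rho[s [s0 ts fin]]; apply: PhiE_moment_fin ts fin. Qed.

(** The full sum of [(k - c) w_k t^k] is nonpositive, and the terms left out are nonnegative since
    [c <= n]. *)
Lemma PsiE_le_partial {R : realType} (w : nat -> R) (t c : R) (n : nat) :
  (forall k, 0 <= w k) -> 0 < w 0%N -> 0 <= t -> (t%:E < rho w)%E ->
  (PsiE w t <= c%:E)%E -> c <= n%:R ->
  \sum_(k < n) (k%:R - c) * (w k * t ^+ k) <= 0.
Proof.
move=> w0 w00 t0 tr Pc cn.
have fin := PhiE_fin_lt_rho w t w0 t0 tr.
have fin1 := PhiE_moment_lt_rho w t w0 t0 tr.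
have m0 := moment_ge0 w w0.
have c0 := pseries_cvg_fine w t w0 t0 fin.
have c1 := pseries_cvg_fine (moment w) t m0 t0 fin1.
have p0 := fine_PhiE_gt0 w t w0 w00 t0 fin.
move: Pc; rewrite PsiE_fin// lee_fin ler_pdivrMr// => Pc.
pose d k := (k%:R - c) * (w k * t ^+ k).
have cd : series d @ \oo --> fine (PhiE (moment w) t) - c * fine (PhiE w t).
  have -> : series d = fun n => pseries (moment w) t n - c * pseries w t n; last first.
    by apply: cvgB => //; apply: cvgMr.
  apply/funext => k; rewrite /pseries /series /= mulr_sumr -sumrB; apply: eq_bigr => i _.
  by rewrite /d /moment; ring.
rewrite -(big_mkord xpredT d) -[leLHS]/(series d n).
apply: (@le_trans _ _ (fine (PhiE (moment w) t) - c * fine (PhiE w t))); last first.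
  by rewrite subr_le0.
have cvd : cvgn (series d) by apply/cvg_ex; eexists; exact: cd.
rewrite -(cvg_lim _ cd)//; apply: limr_ge => //.
exists n => // N /= nN; rewrite -subr_ge0 sub_series_geq//.
rewrite big_nat_cond sumr_ge0// => i /andP[/andP[ni _] _].
rewrite /d mulr_ge0 ?mulr_ge0 ?exprn_ge0// subr_ge0 (le_trans cn)// ler_nat.
by [].
Qed.

Lemma poly_gt_left {R : realType} (p : {poly R}) (r a : R) : 0 < r -> a < p.[r] ->
  exists t, [/\ 0 <= t, t < r & a < p.[t]].
Proof.
move=> r0 ap.
have cp : p.[t] @[t --> r^'-] --> p.[r].
  apply: cvg_at_left_filter; exact: continuous_horner.
near r^'- => t; exists t; split => //.
- by apply: ltW; near: t; apply: nbhs_left_gt.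
- by near: t; apply: (cvgr_gt _ cp).
Unshelve. all: by end_near.
Qed.

(** If Psi stayed below [c], the terms with [k - c >= 1] would be controlled by the finitely many
    others. This bounds Phi uniformly on [0, r), and, by continuity of the partial sums, at [r]
    too. *)
Lemma PsiE_exceeds_of_divergence {R : realType} (w : nat -> R) (r c : R) :
  (forall k, 0 <= w k) -> 0 < w 0%N -> rho w = r%:E -> PhiE w r = +oo%E ->
  0 <= c -> exists t, [/\ 0 <= t, t < r & (c%:E < PsiE w t)%E].
Proof.
move=> w0 w00 rE Pr c0; apply: contrapT => Hno.
have r0 : 0 < r.
  rewrite lt_neqAle; have := rho_ge0 w; rewrite rE lee_fin => ->; rewrite andbT.
  by apply/eqP => r0; move: Pr; rewrite -r0 PhiE0.
have Hle t : 0 <= t -> t < r -> (PsiE w t <= c%:E)%E.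
  by move=> t0 tr; rewrite leNgt; apply/negP => ct; apply: Hno; exists t.
pose N := (Num.truncn (c + 1)).+1.
have Nc : c + 1 <= N%:R by apply: ltW; apply: truncnS_gt.
(* [c] times the head bounds its negative contribution; one more copy counts the head itself. *)
pose C := (c + 1) * \sum_(k < N) w k * r ^+ k.
have bound n t : 0 <= t -> t < r -> \sum_(k < N + n) w k * t ^+ k <= C.
  move=> t0 tr.
  have cN : c <= (N + n)%:R by rewrite natrD; have : 0 <= n%:R :> R by []; lra.
  have := PsiE_le_partial w t c (N + n) w0 w00 t0.
  rewrite rE lte_fin => /(_ tr (Hle t t0 tr) cN).
  rewrite !big_split_ord /= => Hs.
  have h1 : \sum_(i < n) w (N + i)%N * t ^+ (N + i) <=
      \sum_(i < n) ((N + i)%:R - c) * (w (N + i)%N * t ^+ (N + i)).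
    apply: ler_sum => i _; rewrite ler_peMl ?mulr_ge0 ?exprn_ge0//.
    by rewrite natrD; have : 0 <= i%:R :> R by []; lra.
  have h2 : \sum_(i < N) w i * t ^+ i - C <=
      \sum_(i < N) (i%:R - c) * (w i * t ^+ i).
    rewrite /C mulr_sumr -sumrB; apply: ler_sum => i _.
    have : w i * t ^+ i <= w i * r ^+ i.
      by rewrite ler_wpM2l// lerXn2r ?nnegrE// ltW.
    have : 0 <= w i * t ^+ i by rewrite mulr_ge0 ?exprn_ge0.
    have i0 : 0 <= i%:R :> R by [].
    nra.
  lra.
suff : (PhiE w r <= C%:E)%E by rewrite Pr leye_eq.
apply: PhiE_le_bound (ltW r0) _ => // n.
apply: (@le_trans _ _ (\sum_(k < N + n) w k * r ^+ k)).
  rewrite addnC big_split_ord /= lerDl sumr_ge0// => i _.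
  by rewrite mulr_ge0 ?exprn_ge0// ltW.
rewrite leNgt; apply/negP => CP.
have [|t [t0 tr]] := poly_gt_left (wpoly w (N + n)) r C r0.
  by rewrite horner_poly.
by rewrite horner_poly ltNge bound.
Qed.

(** Some [K > c] has positive weight, and for large [t] its term outgrows all lower ones, which are
    of order t^(K-1). *)
Lemma PsiE_exceeds_of_entire {R : realType} (w : nat -> R) (c : R) :
  (forall k, 0 <= w k) -> 0 < w 0%N -> rho w = +oo%E ->
  0 <= c -> (c%:E < omega w)%E -> exists t, 0 <= t /\ (c%:E < PsiE w t)%E.
Proof.
move=> w0 w00 rE c0 /ereal_sup_gt[_ [K /= wK <-]]; rewrite lte_fin => cK.
apply: contrapT => Hno.
have Hle t : 0 <= t -> (PsiE w t <= c%:E)%E.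
  by move=> t0; rewrite leNgt; apply/negP => ct; apply: Hno; exists t.
have a0 : 0 < (K%:R - c) * w K by rewrite mulr_gt0// subr_gt0.
pose C := c * \sum_(i < K) w i.
have C0 : 0 <= C by rewrite mulr_ge0// sumr_ge0.
(* Chosen so that [t] times the coefficient [(K - c) w_K] exceeds the bound [C] on the lower
   terms. *)
pose t := 1 + C / ((K%:R - c) * w K).
have t1 : 1 <= t by rewrite lerDl divr_ge0// ltW.
have t0 : 0 <= t by apply: le_trans t1.
have tlt : (t%:E < rho w)%E by rewrite rE ltry.
have cK1 : c <= K.+1%:R by rewrite -natr1; lra.
have := PsiE_le_partial w t c K.+1 w0 w00 t0 tlt (Hle t t0) cK1.
rewrite big_ord_recr /= => Hs.
have h : - (C * t ^+ K) <= t * \sum_(i < K) (i%:R - c) * (w i * t ^+ i).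
  rewrite /C mulr_sumr mulr_suml -sumrN mulr_sumr; apply: ler_sum => i _.
  have : w i * t ^+ i * t <= w i * t ^+ K.
    by rewrite -mulrA -exprSr ler_wpM2l// ler_weXn2l.
  have : 0 <= w i * t ^+ i * t by rewrite !mulr_ge0 ?exprn_ge0.
  have i0 : 0 <= i%:R :> R by [].
  nra.
have tK : 0 < t ^+ K by rewrite exprn_gt0// (lt_le_trans ltr01).
have := ler_wpM2l t0 Hs; rewrite mulr0 mulrDr.
have -> : t * ((K%:R - c) * (w K * t ^+ K)) = ((K%:R - c) * w K + C) * t ^+ K.
  have -> : (K%:R - c) * w K + C = (K%:R - c) * w K * t.
    by rewrite /t mulrDr mulr1 mulrCA divff ?mulr1// gt_eqF.
  ring.
have := mulr_gt0 a0 tK; lra.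
Qed.

(** A partial sum of the numerator already exceeds [lam * Phi(r)] at [r], hence also slightly to the
    left, where Phi is no larger. An infinite [PsiE w r] is covered. *)
Lemma PsiE_exceeds_of_convergence {R : realType} (w : nat -> R) (r lam : R) :
  (forall k, 0 <= w k) -> 0 < w 0%N -> 0 <= r -> (PhiE w r < +oo)%E ->
  0 <= lam -> (lam%:E < PsiE w r)%E ->
  exists t, [/\ 0 <= t, t < r & (lam%:E < PsiE w t)%E].
Proof.
move=> w0 w00 r0 fin lam0 lP.
have {}r0 : 0 < r.
  rewrite lt_neqAle r0 andbT; apply/eqP => r00; move: lP.
  by rewrite -r00 PsiE0 lte_fin ltNge lam0.
have m0 := moment_ge0 w w0.
have p0 := fine_PhiE_gt0 w r w0 w00 (ltW r0) fin.
have [n Hn] : exists n, lam * fine (PhiE w r) < (wpoly (moment w) n).[r].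
  apply: contrapT => Hno; move: lP; apply/negP; rewrite -leNgt.
  have b : (PhiE (moment w) r <= (lam * fine (PhiE w r))%:E)%E.
    apply: PhiE_le_bound (ltW r0) _ => // n; rewrite leNgt; apply/negP => h.
    by apply: Hno; exists n; rewrite horner_poly.
  have fin1 : (PhiE (moment w) r < +oo)%E by apply: le_lt_trans b (ltry _).
  rewrite PsiE_fin ?(ltW r0)// lee_fin ler_pdivrMr// -lee_fin.
  by rewrite PhiE_fineK// ltW.
have [t [t0 tr ht]] := poly_gt_left _ _ _ r0 Hn.
exists t; split => //.
have fint1 := PhiE_moment_fin w t r w0 t0 tr fin.
have fint : (PhiE w t < +oo)%E.
  by apply: le_lt_trans fin; apply: PhiE_le_mono => //; apply: ltW.
have q0 := fine_PhiE_gt0 w t w0 w00 t0 fint.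
rewrite PsiE_fin// lte_fin ltr_pdivlMr//.
have le0 : fine (PhiE w t) <= fine (PhiE w r).
  by rewrite -lee_fin !PhiE_fineK// ?PhiE_le_mono// ltW.
have := PhiE_ge_partial (moment w) t n m0 t0.
rewrite -(PhiE_fineK (moment w) t)// lee_fin -horner_poly -/(wpoly _ _).
have := ler_wpM2l lam0 le0; lra.
Qed.

Lemma PsiE_nondecreasing {R : realType} (w : nat -> R) (s t : R) :
  (forall k, 0 <= w k) -> 0 < w 0%N -> (exists k, (1 <= k)%N /\ 0 < w k) ->
  0 <= s -> s <= t -> (PhiE w t < +oo)%E -> (PsiE w s <= PsiE w t)%E.
Proof.
move=> w0 w00 wk s0; rewrite le_eqVlt => /orP[/eqP->//|st] fin.
exact/ltW/PsiE_lt.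
Qed.

(** * The limit value nu *)

Lemma nu_finite {R : realType} (w : nat -> R) (r : R) :
  rho w = r%:E -> (PhiE w r < +oo)%E -> nu w = PsiE w r.
Proof. by move=> rE fin; rewrite /nu rE fin. Qed.

Lemma nu_divergent {R : realType} (w : nat -> R) (r : R) :
  (forall k, 0 <= w k) -> 0 < w 0%N -> (exists k, (1 <= k)%N /\ 0 < w k) ->
  rho w = r%:E -> PhiE w r = +oo%E -> nu w = +oo%E.
Proof.
move=> w0 w00 wk rE Pr; rewrite /nu rE Pr ltxx; apply/cvg_lim => //.
apply/cvgeyPge => A.
have A0 : 0 <= Num.max A 0 by rewrite le_max lexx orbT.
have [t [t0 tr At]] := PsiE_exceeds_of_divergence w r _ w0 w00 rE Pr A0.
near=> s; apply: (@le_trans _ _ (PsiE w t)).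
  by apply: le_trans (ltW At); rewrite lee_fin le_max lexx.
have ts : t < s by near: s; apply: nbhs_left_gt.
apply: PsiE_nondecreasing => //; first exact: ltW.
apply: PhiE_fin_lt_rho => //; first exact: ltW (le_lt_trans t0 ts).
by rewrite rE lte_fin; near: s; apply: nbhs_left_lt.
Unshelve. all: by end_near.
Qed.

Lemma nu_entire {R : realType} (w : nat -> R) (lam : R) :
  (forall k, 0 <= w k) -> 0 < w 0%N -> (exists k, (1 <= k)%N /\ 0 < w k) ->
  rho w = +oo%E -> 0 <= lam -> (lam%:E < omega w)%E -> (lam%:E < nu w)%E.
Proof.
move=> w0 w00 wk rE lam0 lo; rewrite /nu rE.
have [t [t0 lt]] := PsiE_exceeds_of_entire w lam w0 w00 rE lam0 lo.
have fin s : 0 <= s -> (PhiE w s < +oo)%E.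
  by move=> s0; apply: PhiE_fin_lt_rho => //; rewrite rE ltry.
(* Freezing negative arguments at 0 gives a function monotone on the whole line, whose limit is its
   supremum. *)
have nd : nondecreasing_fun (fun x => PsiE w (Num.max 0 x)).
  move=> x y xy; apply: PsiE_nondecreasing => //; first by rewrite le_max lexx.
    by rewrite ge_max !le_max lexx xy orbT.
  by apply: fin; rewrite le_max lexx.
have cv : PsiE w s @[s --> +oo] --> ereal_sup (range (fun x => PsiE w (Num.max 0 x))).
  apply: cvg_trans (nondecreasing_cvge nd); apply: near_eq_cvg.
  near=> s; rewrite max_r//; near: s; exact: nbhs_pinfty_ge.
rewrite (cvg_lim _ cv)//; apply: (lt_le_trans lt).
by apply: ereal_sup_ubound; exists t => //; rewrite max_r.
Unshelve. all: by end_near.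
Qed.

(** * The variance of the tilted law *)

(** Divided by Phi(t), its generating function is the second moment about [c] of the law tilted by
    [t]. Since [c] does not vary with [t], the coefficients are fixed and nonnegative, which allows
    monotone limits at the radius. *)
Definition centred {R : realType} (w : nat -> R) (c : R) : nat -> R :=
  fun k => (k%:R - c) ^+ 2 * w k.

Lemma centred_ge0 {R : realType} (w : nat -> R) (c : R) :
  (forall k, 0 <= w k) -> forall k, 0 <= centred w c k.
Proof. by move=> w0 k; rewrite mulr_ge0// sqr_ge0. Qed.

Lemma cvgn_diffs {R : realType} (u : nat -> R) (t s : R) :
  (forall k, 0 <= u k) -> 0 <= t -> t < s -> (PhiE u s < +oo)%E ->
  cvgn (pseries (pseries_diffs u) t).
Proof.
move=> u0 t0 ts fin; pose K := (t + s) / 2.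
have tK : t < K by rewrite /K; lra.
have K0 : 0 < K by apply: le_lt_trans tK.
have Ks : K < s by rewrite /K; lra.
apply: (@is_cvg_pseries_inside _ _ K); last by rewrite !ger0_norm// ltW.
apply/cvg_ex; eexists; apply: pseries_cvg_fine (ltW K0) _.
  exact: pseries_diffs_ge0.
exact: PhiE_diffs_fin Ks fin.
Qed.

Lemma is_derive_pseries {R : realType} (u : nat -> R) (t s : R) :
  (forall k, 0 <= u k) -> 0 <= t -> t < s -> (PhiE u s < +oo)%E ->
  is_derive t (1 : R) (fun x => limn (pseries u x))
    (limn (pseries (pseries_diffs u) t)).
Proof.
(* Termwise differentiation needs the first and second derived series to converge at [K]; each
   derivation uses up some of the gap below [s]. *)
move=> u0 t0 ts fin; pose K := (t + s) / 2; pose K' := (K + s) / 2.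
have tK : t < K by rewrite /K; lra.
have K0 : 0 < K by apply: le_lt_trans tK.
have Ks : K < s by rewrite /K; lra.
have KK' : K < K' by rewrite /K'; lra.
have K's : K' < s by rewrite /K'; lra.
have K'0 : 0 < K' by apply: lt_trans KK'.
have d0 := pseries_diffs_ge0 u u0.
apply: (@pseries_snd_diffs _ _ K); last by rewrite !ger0_norm// ltW.
- apply/cvg_ex; eexists; apply: pseries_cvg_fine (ltW K0) _ => //.
  by apply: le_lt_trans fin; apply: PhiE_le_mono => //; apply: ltW.
- exact: cvgn_diffs (ltW K0) Ks fin.
- by apply: cvgn_diffs (ltW K0) KK' _ => //; exact: PhiE_diffs_fin K's fin.
Qed.

Lemma mul_lim_diffs {R : realType} (u : nat -> R) (t s : R) :
  (forall k, 0 <= u k) -> 0 <= t -> t < s -> (PhiE u s < +oo)%E ->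
  t * limn (pseries (pseries_diffs u) t) = fine (PhiE (moment u) t).
Proof.
move=> u0 t0 ts fin.
have /pseries_diffs_equiv H := cvgn_diffs u t s u0 t0 ts fin.
have -> : PhiE (moment u) t = (t * limn (pseries (pseries_diffs u) t))%:E; last by [].
apply: PhiE_of_cvg.
have -> : pseries (moment u) t = fun n => t * series (fun i => i%:R * u i * t ^+ i.-1) n.
  apply/funext => n; rewrite /pseries /series /= mulr_sumr; apply: eq_bigr => -[|i] _.
    by rewrite /moment !mul0r mulr0.
  by rewrite /moment /= exprS mulrCA.
by apply: cvgMr.
Qed.

Lemma PhiE_centred {R : realType} (w : nat -> R) (c t s : R) :
  (forall k, 0 <= w k) -> 0 <= t -> t < s -> (PhiE w s < +oo)%E ->
  PhiE (centred w c) t = (fine (PhiE (moment (moment w)) t) -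
    2 * c * fine (PhiE (moment w) t) + c ^+ 2 * fine (PhiE w t))%:E.
Proof.
move=> w0 t0 ts fin; pose K := (t + s) / 2.
have tK : t < K by rewrite /K; lra.
have K0 : 0 <= K by apply: ltW; apply: le_lt_trans tK.
have Ks : K < s by rewrite /K; lra.
have m0 := moment_ge0 w w0.
have f0 : (PhiE w t < +oo)%E.
  by apply: le_lt_trans fin; apply: PhiE_le_mono => //; apply: ltW.
have f1 := PhiE_moment_fin w t s w0 t0 ts fin.
have f2 := PhiE_moment_fin (moment w) t K m0 t0 tK (PhiE_moment_fin w K s w0 K0 Ks fin).
have c0 := pseries_cvg_fine w t w0 t0 f0.
have c1 := pseries_cvg_fine (moment w) t m0 t0 f1.
have c2 := pseries_cvg_fine (moment (moment w)) t (moment_ge0 _ m0) t0 f2.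
apply: PhiE_of_cvg.
have -> : pseries (centred w c) t = fun n => pseries (moment (moment w)) t n -
    2 * c * pseries (moment w) t n + c ^+ 2 * pseries w t n.
  apply/funext => n; rewrite /pseries /series /= !mulr_sumr -sumrB -big_split /=.
  by apply: eq_bigr => i _; rewrite /centred /moment; ring.
by apply: cvgD; [apply: cvgB => //; apply: cvgMr|apply: cvgMr].
Qed.

Lemma PsiR_E {R : realType} (w : nat -> R) (t : R) :
  (forall k, 0 <= w k) -> 0 <= t -> (PhiE w t < +oo)%E ->
  (PhiE (moment w) t < +oo)%E ->
  PsiR w t = fine (PhiE (moment w) t) / fine (PhiE w t).
Proof.
move=> w0 t0 f0 f1.
have c0 := pseries_cvg_fine w t w0 t0 f0.
have c1 := pseries_cvg_fine (moment w) t (moment_ge0 _ w0) t0 f1.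
rewrite /PsiR -/(pseries w t) -/(pseries (moment w) t).
by rewrite (cvg_lim _ c0)// (cvg_lim _ c1).
Qed.

Lemma is_derive_quotient {R : realType} (F G : R -> R) (t a b : R) :
  is_derive t (1 : R) F a -> is_derive t (1 : R) G b -> F t != 0 ->
  is_derive t (1 : R) (fun x => G x / F x) ((b * F t - G t * a) / F t ^+ 2).
Proof.
move=> [DF EF] [DG EG] F0; have DV := derivableV F0 DF.
have PE : (fun x => G x / F x) = G * (fun x => (F x)^-1) by [].
have DV' : is_derive t (1 : R) (fun x => (F x)^-1) (- F t ^- 2 *: a).
  by split; [exact: DV|rewrite (deriveV F0 DF) EF].
have DG' : is_derive t (1 : R) G b by split.
rewrite PE; apply: is_derive_eq (is_deriveM DG' DV') _.
rewrite /GRing.scale /=; field.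
exact: F0.
Qed.

(* [s * Psi'(s)] is the variance of the law tilted by [s]. *)
Lemma PsiR_derivative {R : realType} (w : nat -> R) (c t s : R) :
  (forall k, 0 <= w k) -> 0 < w 0%N -> 0 <= t -> t < s -> (PhiE w s < +oo)%E ->
  derivable (PsiR w) t 1 /\
  t * derive1 (PsiR w) t = fine (PhiE (centred w c) t) / fine (PhiE w t) -
    (PsiR w t - c) ^+ 2.
Proof.
move=> w0 w00 t0 ts fin; pose K := (t + s) / 2.
have tK : t < K by rewrite /K; lra.
have K0 : 0 <= K by apply: ltW; apply: le_lt_trans tK.
have Ks : K < s by rewrite /K; lra.
have m0 := moment_ge0 w w0.
have f0 : (PhiE w t < +oo)%E.
  by apply: le_lt_trans fin; apply: PhiE_le_mono => //; apply: ltW.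
have f1 := PhiE_moment_fin w t s w0 t0 ts fin.
have fK1 := PhiE_moment_fin w K s w0 K0 Ks fin.
have D0 := is_derive_pseries w t s w0 t0 ts fin.
have D1 := is_derive_pseries (moment w) t K m0 t0 tK fK1.
have M0 := mul_lim_diffs w t s w0 t0 ts fin.
have M1 := mul_lim_diffs (moment w) t K m0 t0 tK fK1.
have c0 := pseries_cvg_fine w t w0 t0 f0.
have c1 := pseries_cvg_fine (moment w) t m0 t0 f1.
have p0 := fine_PhiE_gt0 w t w0 w00 t0 f0.
pose F x := limn (pseries w x); pose G x := limn (pseries (moment w) x).
have Ft : F t = fine (PhiE w t) by apply/cvg_lim.
have Gt : G t = fine (PhiE (moment w) t) by apply/cvg_lim.
have Fn0 : F t != 0 by rewrite Ft gt_eqF.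
have [DQ EQ] : is_derive t (1 : R) (PsiR w) ((limn (pseries (pseries_diffs (moment w)) t) * F t -
    G t * limn (pseries (pseries_diffs w) t)) / F t ^+ 2).
  exact: is_derive_quotient.
split; first exact: DQ.
rewrite derive1E EQ.
rewrite (PhiE_centred w c t s w0 t0 ts fin) /= PsiR_E// Ft Gt.
set a := limn (pseries (pseries_diffs w) t) in M0 *.
set b := limn _ in M1 *.
set S0 := fine (PhiE w t) in p0 M0 *; set S1 := fine (PhiE (moment w) t) in M0 *.
have -> : t * ((b * S0 - S1 * a) / S0 ^+ 2) = ((t * b) * S0 - S1 * (t * a)) / S0 ^+ 2.
  ring.
rewrite M0 M1; field; exact: lt0r_neq0.
Qed.

Lemma PsiE_PsiR {R : realType} (w : nat -> R) (t : R) :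
  (forall k, 0 <= w k) -> 0 <= t -> (t%:E < rho w)%E -> PsiE w t = (PsiR w t)%:E.
Proof.
move=> w0 t0 tr; have f1 := PhiE_moment_lt_rho w t w0 t0 tr.
by rewrite PsiE_fin// PsiR_E//; exact: PhiE_fin_lt_rho.
Qed.

Lemma PsiE_attains {R : realType} (w : nat -> R) (t lam : R) :
  (forall k, 0 <= w k) -> 0 < w 0%N -> 0 <= t -> (t%:E < rho w)%E -> 0 <= lam ->
  (lam%:E <= PsiE w t)%E -> exists tau, [/\ 0 <= tau, tau <= t & PsiE w tau = lam%:E].
Proof.
move=> w0 w00 t0 tr lam0.
rewrite PsiE_PsiR// lee_fin => lP.
have [s [s0 ts fin]] := lt_rho w t tr.
have R0 : PsiR w 0 = 0.
  have r0 : (0%:E < rho w)%E by apply: le_lt_trans tr; rewrite lee_fin.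
  by have := PsiE_PsiR w 0 w0 (lexx _) r0; rewrite PsiE0 => -[].
have cont : {within `[0, t], continuous (PsiR w)}.
  apply: continuous_in_subspaceT => x; rewrite inE /= in_itv /= => /andP[x0 xt].
  apply: differentiable_continuous; apply/derivable1_diffP.
  by have [] := PsiR_derivative w 0 x s w0 w00 x0 (le_lt_trans xt ts) fin.
have [|tau] := IVT t0 cont (v := lam).
  by rewrite R0 ge_min lam0 le_max lP orbT.
rewrite in_itv /= => /andP[tau0 taut] E; exists tau; split => //.
rewrite PsiE_PsiR ?E//; apply: le_lt_trans tr; by rewrite lee_fin.
Qed.

(** Abel's limit theorem for nonnegative coefficients: continuous partial sums bound the limit
    below, monotonicity bounds it above. The value at [r] may be infinite. *)
Lemma PhiE_cvg_left {R : realType} (u : nat -> R) (r : R) :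
  (forall k, 0 <= u k) -> 0 < r -> PhiE u t @[t --> r^'-] --> PhiE u r.
Proof.
move=> u0 r0.
have below (a : R) : (a%:E < PhiE u r)%E ->
    \forall t \near r^'-, (a%:E <= PhiE u t)%E.
  move=> ar; have [n Hn] : exists n, a < (wpoly u n).[r].
    apply: contrapT => Hno; move: ar; apply/negP; rewrite -leNgt.
    apply: PhiE_le_bound (ltW r0) _ => // n; rewrite leNgt; apply/negP => h.
    by apply: Hno; exists n; rewrite horner_poly.
  have [t0 [t00 t0r at0]] := poly_gt_left _ _ _ r0 Hn.
  near=> t; have tt : t0 <= t by apply: ltW; near: t; apply: nbhs_left_gt.
  apply: (@le_trans _ _ (PhiE u t0)); last exact: PhiE_le_mono.
  apply: le_trans (PhiE_ge_partial u t0 n u0 t00).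
  by rewrite lee_fin -horner_poly ltW.
have above : \forall t \near r^'-, 0 <= t /\ (PhiE u t <= PhiE u r)%E.
  near=> t; have t0 : 0 <= t by apply: ltW; near: t; apply: nbhs_left_gt.
  by split => //; apply: PhiE_le_mono => //; apply: ltW; near: t; apply: nbhs_left_lt.
have [e|] := eqVneq (PhiE u r) +oo%E.
  by rewrite e; apply/cvgeyPge => A; apply: below; rewrite e ltry.
rewrite -ltey => fin; rewrite -(PhiE_fineK u r u0 (ltW r0) fin).
apply/fine_cvgP; split.
  near=> t; have [t0 tr] : 0 <= t /\ (PhiE u t <= PhiE u r)%E by near: t; exact: above.
  by rewrite ge0_fin_numE ?PhiE_ge0// (le_lt_trans tr).
apply/cvgrPdist_le => e e0.
have ar : ((fine (PhiE u r) - e)%:E < PhiE u r)%E.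
  by rewrite -[ltRHS](PhiE_fineK u r u0 (ltW r0) fin) lte_fin ltrBlDr ltrDl.
near=> t; have [t0 tr] : 0 <= t /\ (PhiE u t <= PhiE u r)%E by near: t; exact: above.
have art : ((fine (PhiE u r) - e)%:E <= PhiE u t)%E by near: t; apply: below.
have fint : (PhiE u t < +oo)%E by apply: le_lt_trans fin.
move: art tr; rewrite /= -(PhiE_fineK u t u0 t0 fint) -[in X in _ -> X -> _](PhiE_fineK u r u0 (ltW r0) fin).
rewrite !lee_fin /= => art tr; rewrite ger0_norm ?subr_ge0//; lra.
Unshelve. all: by end_near.
Qed.

Lemma cvg_EFin_fun {R : realType} (F : set_system R) {FF : Filter F} (f : R -> R) (a : R) :
  f @ F --> a -> (f x)%:E @[x --> F] --> a%:E.
Proof. by move=> fa; apply: cvg_EFin => //; apply: nearW. Qed.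

(** In the identity of [PsiR_derivative] with [c] = Psi(r), the correction (Psi(s) - c)^2 tends to 0
    as [s] increases to [r], while the second moment about [c] converges, possibly to infinity. *)
Lemma PsiD_rho {R : realType} (w : nat -> R) (r c : R) :
  (forall k, 0 <= w k) -> 0 < w 0%N -> 0 < r -> rho w = r%:E ->
  (PhiE w r < +oo)%E -> PsiE w r = c%:E ->
  (r%:E * PsiD w r)%E = (PhiE (centred w c) r * ((fine (PhiE w r))^-1)%:E)%E.
Proof.
move=> w0 w00 r0 rE fin Pr.
have m0 := moment_ge0 w w0.
have fin1 : (PhiE (moment w) r < +oo)%E.
  rewrite ltey; apply/eqP => e; move: Pr.
  by rewrite PsiE_infty// ltW.
have p0 := fine_PhiE_gt0 w r w0 w00 (ltW r0) fin.
have cE : c = fine (PhiE (moment w) r) / fine (PhiE w r).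
  by move: Pr; rewrite PsiE_fin ?(ltW r0)// => -[].
have lim0 : fine (PhiE w t) @[t --> r^'-] --> fine (PhiE w r).
  by apply: fine_cvg; rewrite PhiE_fineK ?(ltW r0)//; exact: PhiE_cvg_left.
have lim1 : fine (PhiE (moment w) t) @[t --> r^'-] --> fine (PhiE (moment w) r).
  by apply: fine_cvg; rewrite PhiE_fineK ?(ltW r0)//; exact: PhiE_cvg_left.
have idr : (t : R) @[t --> r^'-] --> r by apply: cvg_at_left_filter; exact: cvg_id.
have limV : PhiE (centred w c) t @[t --> r^'-] --> PhiE (centred w c) r.
  by apply: PhiE_cvg_left => //; exact: centred_ge0.
pose q t := (t * fine (PhiE w t))^-1.
pose h t := (fine (PhiE (moment w) t) / fine (PhiE w t) - c) ^+ 2 / t.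
have limq : q t @[t --> r^'-] --> (r * fine (PhiE w r))^-1.
  by apply: cvgV; [rewrite mulf_neq0 ?gt_eqF|apply: cvgM].
have limh : h t @[t --> r^'-] --> (0 : R).
  have -> : 0 = (fine (PhiE (moment w) r) / fine (PhiE w r) - c) ^+ 2 / r :> R.
    by rewrite -cE subrr expr0n mul0r.
  apply: cvgM; last by apply: cvgV => //; rewrite gt_eqF.
  have lb : fine (PhiE (moment w) t) / fine (PhiE w t) - c @[t --> r^'-] -->
      fine (PhiE (moment w) r) / fine (PhiE w r) - c.
    by apply: cvgB; [apply: cvgM => //; apply: cvgV => //; rewrite gt_eqF|exact: cvg_cst].
  by apply: cvgM.
have V0 := PhiE_ge0 (centred w c) r (centred_ge0 w c w0) (ltW r0).
have rp0 : 0 < r * fine (PhiE w r) by rewrite mulr_gt0.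
have limD : (derive1 (PsiR w) s)%:E @[s --> r^'-] -->
    (PhiE (centred w c) r * ((r * fine (PhiE w r))^-1)%:E)%E.
  have : (PhiE (centred w c) s * (q s)%:E - (h s)%:E)%E @[s --> r^'-] -->
      (PhiE (centred w c) r * ((r * fine (PhiE w r))^-1)%:E - 0%:E)%E.
    apply: cvgeB; first by rewrite fin_num_adde_defl.
      apply: cvgeM => //; last exact: cvg_EFin_fun.
      have [Vf|Vi] := boolP (PhiE (centred w c) r \is a fin_num).
        exact: mule_def_fin.
      by apply: mule_def_infty_neq0 => //; rewrite eqe invr_eq0 gt_eqF.
    exact: cvg_EFin_fun.
  rewrite sube0; apply: cvg_trans; apply: near_eq_cvg.
  near=> s; have s0 : 0 < s by near: s; apply: nbhs_left_gt.
  have sr : s < r by near: s; apply: nbhs_left_lt.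
  have [_ ] := PsiR_derivative w c s r w0 w00 (ltW s0) sr fin.
  have fs : (PhiE w s < +oo)%E.
    by apply: le_lt_trans fin; apply: PhiE_le_mono => //; apply: ltW.
  have fs1 := PhiE_moment_fin w s r w0 (ltW s0) sr fin.
  have q0 := fine_PhiE_gt0 w s w0 w00 (ltW s0) fs.
  rewrite PsiR_E ?(ltW s0)// (PhiE_centred w c s r w0 (ltW s0) sr fin) /= => E.
  rewrite -EFinM -EFinB; congr EFin.
  apply: (mulfI (lt0r_neq0 s0)); rewrite E /q /h.
  field; rewrite ?lt0r_neq0//.
rewrite /PsiD rE ltxx (cvg_lim _ limD)// muleC -muleA -EFinM; congr (_ * _%:E)%E.
by rewrite invfM mulrAC mulVf ?mul1r// gt_eqF.
Unshelve. all: by end_near.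
Qed.

(** Otherwise the series would be dominated by a geometric one from [L0] on. *)
Lemma weight_growth {R : realType} (w : nat -> R) (x q : R) (L0 : nat) :
  (forall k, 0 <= w k) -> 0 <= x -> PhiE w x = +oo%E -> 0 <= q -> q < 1 ->
  exists L, (L0 <= L)%N /\ q ^+ L <= w L * x ^+ L.
Proof.
move=> w0 x0 Px q0 q1; apply: contrapT => Hno.
have Hlt L : (L0 <= L)%N -> w L * x ^+ L <= q ^+ L.
  move=> L0L; rewrite leNgt; apply/negP => h; apply: Hno; exists L.
  by rewrite L0L ltW.
pose C := \sum_(i < L0) w i * x ^+ i + (1 - q)^-1.
suff : (PhiE w x <= C%:E)%E by rewrite Px leye_eq.
apply: PhiE_le_bound => // n.
apply: (@le_trans _ _ (\sum_(i < L0 + n) w i * x ^+ i)).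
  rewrite addnC big_split_ord /= lerDl sumr_ge0// => i _.
  by rewrite mulr_ge0 ?exprn_ge0.
rewrite big_split_ord /= lerD2l.
apply: (@le_trans _ _ (\sum_(i < n) q ^+ i)).
  apply: ler_sum => i _; apply: (le_trans (Hlt _ (leq_addr _ _))).
  by rewrite ler_wiXn2l ?leq_addl// ltW.
have d0 : 0 < 1 - q by rewrite subr_gt0.
rewrite -[leRHS]mul1r ler_pdivlMr// mulrC -opprB mulNr -subrX1 opprB.
by rewrite lerBlDr lerDl exprn_ge0.
Qed.

(** * The parameter tau *)

Lemma nneseries_scaled {R : realType} (u : nat -> R) (c t : R) :
  (forall k, 0 <= u k) -> 0 <= t ->
  (\sum_(k <oo) (c * (u k * t ^+ k))%:E = c%:E * PhiE u t)%E.
Proof.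
move=> u0 t0; rewrite /PhiE -nneseriesZl//.
by move=> i _; rewrite lee_fin mulr_ge0 ?exprn_ge0.
Qed.

Lemma PsiX_lt_rho {R : realType} (w : nat -> R) (t : R) :
  (t%:E < rho w)%E -> PsiX w t = PsiE w t.
Proof. by move=> tr; rewrite /PsiX lt_eqF. Qed.

Lemma PsiX_rho {R : realType} (w : nat -> R) (t : R) :
  t%:E = rho w -> PsiX w t = nu w.
Proof. by move=> tr; rewrite /PsiX tr eqxx. Qed.

Lemma PsiX_increasing {R : realType} (w : nat -> R) (s t : R) :
  (forall k, 0 <= w k) -> 0 < w 0%N -> (exists k, (1 <= k)%N /\ 0 < w k) ->
  0 <= s -> s < t -> (t%:E <= rho w)%E -> (PsiX w s < PsiX w t)%E.
Proof.
move=> w0 w00 wk s0 st tr.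
have sr : (s%:E < rho w)%E by apply: lt_le_trans tr; rewrite lte_fin.
have t0 : 0 <= t by apply: ltW; apply: le_lt_trans st.
rewrite (PsiX_lt_rho _ _ sr); move: tr; rewrite le_eqVlt => /orP[/eqP tr|tr]; last first.
  by rewrite PsiX_lt_rho//; apply: PsiE_lt => //; exact: PhiE_fin_lt_rho.
rewrite PsiX_rho//; have [e|] := eqVneq (PhiE w t) +oo%E.
  by rewrite (nu_divergent w t)// PsiE_PsiR// ltry.
by rewrite -ltey => fin; rewrite (nu_finite w t)//; exact: PsiE_lt.
Qed.

(** If [rho] is infinite or Phi diverges there, Psi exceeds [lam] inside and the intermediate value
    theorem applies; otherwise [lam] is compared with nu = Psi(rho). The equality of [PsiX] and
    [PsiE] at [tau] lets later arguments work with the series. *)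
Lemma exists_tau {R : realType} (w : nat -> R) (lam : R) :
  (forall k, 0 <= w k) -> 0 < w 0%N -> (exists k, (1 <= k)%N /\ 0 < w k) ->
  0 <= lam -> (lam%:E < omega w)%E ->
  exists tau, [/\ 0 <= tau, (tau%:E <= rho w)%E, (PhiE w tau < +oo)%E,
    PsiX w tau = PsiE w tau &
    ((lam%:E <= nu w)%E /\ PsiE w tau = lam%:E) \/
    [/\ (nu w < lam%:E)%E, tau%:E = rho w & PsiE w tau = nu w]].
Proof.
move=> w0 w00 wk lam0 lo.
have interior t : 0 <= t -> (t%:E < rho w)%E -> (lam%:E < PsiE w t)%E ->
    (lam%:E <= nu w)%E -> exists tau, [/\ 0 <= tau, (tau%:E <= rho w)%E, (PhiE w tau < +oo)%E,
    PsiX w tau = PsiE w tau &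
    ((lam%:E <= nu w)%E /\ PsiE w tau = lam%:E) \/
    [/\ (nu w < lam%:E)%E, tau%:E = rho w & PsiE w tau = nu w]].
  move=> t0 tr lP lnu.
  have [tau [tau0 taut E]] := PsiE_attains w t lam w0 w00 t0 tr lam0 (ltW lP).
  have taur : (tau%:E < rho w)%E by apply: le_lt_trans tr; rewrite lee_fin.
  exists tau; split => //; [exact: ltW|exact: PhiE_fin_lt_rho|exact: PsiX_lt_rho|].
  by left.
have [[r rE]|rE] : (exists r, rho w = r%:E) \/ rho w = +oo%E.
- by case: (rho w) (rho_ge0 w) => [r| |]// _; [left; exists r|right].
- have r0 : 0 <= r by rewrite -lee_fin -rE rho_ge0.
  have [e|] := eqVneq (PhiE w r) +oo%E.
    have [t [t0 tr lP]] := PsiE_exceeds_of_divergence w r lam w0 w00 rE e lam0.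
    apply: (interior t) => //; first by rewrite rE lte_fin.
    by rewrite (nu_divergent w r)// leey.
  rewrite -ltey => fin; have nuE := nu_finite w r rE fin.
  have [lnu|[lnu|lnu]] :
      (lam%:E < nu w)%E \/ (nu w < lam%:E)%E \/ lam%:E = nu w.
    by case: (ltgtP lam%:E (nu w)) => ?; [left|right; left|right; right].
  - rewrite nuE in lnu.
    have [t [t0 tr lP]] := PsiE_exceeds_of_convergence w r lam w0 w00 r0 fin lam0 lnu.
    apply: (interior t) => //; first by rewrite rE lte_fin.
    by rewrite nuE ltW.
  - exists r; split => //; [by rewrite rE|by rewrite PsiX_rho ?rE|].
    by right; rewrite rE -nuE.
  - exists r; split => //; [by rewrite rE|by rewrite PsiX_rho ?rE|].
    by left; rewrite -nuE lnu.
- have [t [t0 lP]] := PsiE_exceeds_of_entire w lam w0 w00 rE lam0 lo.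
  apply: (interior t) => //; first by rewrite rE ltry.
  exact/ltW/nu_entire.
Qed.

Lemma centred_tau {R : realType} (w : nat -> R) (tau c : R) :
  (forall k, 0 <= w k) -> 0 < w 0%N -> 0 <= tau -> (tau%:E <= rho w)%E ->
  (PhiE w tau < +oo)%E -> PsiE w tau = c%:E ->
  (PhiE (centred w c) tau * ((fine (PhiE w tau))^-1)%:E = tau%:E * PsiD w tau)%E.
Proof.
move=> w0 w00 t0; rewrite le_eqVlt => /orP[/eqP tr|tr] fin Pc.
  (* For [tau = rho = 0] the left limit in [PsiD] carries no information, but it is multiplied by 0,
     and the law is a point mass. *)
  have [te0|tn0] := eqVneq tau 0.
    move: Pc; rewrite te0 PsiE0 => -[<-].
    by rewrite mul0e PhiE0 /centred subrr expr0n mul0r mul0e.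
  by rewrite (PsiD_rho w tau c)// lt_neqAle eq_sym tn0.
have [s [s0 ts fins]] := lt_rho w tau tr.
have [_ E] := PsiR_derivative w c tau s w0 w00 t0 ts fins.
have Rc : PsiR w tau = c by move: Pc; rewrite PsiE_PsiR// => -[].
rewrite /PsiD tr -EFinM E Rc subrr expr0n subr0.
by rewrite (PhiE_centred w c tau s w0 t0 ts fins) -EFinM.
Qed.

(** * Values that supply the missing mass *)

(** Phi diverges at [r * expR eta], so [w L * r ^+ L >= expR (- (2 * eta * L))] for arbitrarily
    large [L]. With [d = 2 * lam / L] such boxes supply [2 * lam] per box at small cost. *)
Lemma growth_at_boundary {R : realType} (w : nat -> R) (r lam mu c e : R) :
  (forall k, 0 <= w k) -> 0 < r -> rho w = r%:E -> 0 < c -> 0 < lam -> 0 <= mu ->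
  0 < e -> exists (L : nat) (d : R),
    [/\ 0 < d, d < e, lam - (1 - d) * mu < d * L%:R, 0 < c * (w L * r ^+ L) &
        - (d * ln (c * (w L * r ^+ L))) <= e].
Proof.
(* The factor 8 makes the cost [d * (2 * eta * L) = 4 * lam * eta] equal to [e / 2]. *)
move=> w0 r0 rE c0 lam0 mu0 e0; pose eta := e / (8 * lam).
have eta0 : 0 < eta by rewrite divr_gt0 ?mulr_gt0.
have etaE : 8 * lam * eta = e by rewrite /eta mulrC divfK// gt_eqF ?mulr_gt0.
pose x := r * expR eta.
have rx : r < x by rewrite ltr_pMr// expR_gt1.
have x0 : 0 <= x by rewrite ltW// (lt_trans r0).
have Px : PhiE w x = +oo%E.
  apply/eqP; rewrite -leye_eq leNgt; apply/negP => fin.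
  by have := PhiE_fin_le_rho w x x0 fin; rewrite rE lee_fin leNgt rx.
have q1 : expR (- eta) < 1 by rewrite expR_lt1 oppr_lt0.
(* The three summands ensure [d * mu < lam], [d < e] and [d * |ln c| <= e / 2]. *)
pose A := 2 * mu + 2 * lam / e + 4 * lam * `|ln c| / e.
have [L [AL HL]] := weight_growth w x _ (Num.truncn A).+1 w0 x0 Px (expR_ge0 (- eta)) q1.
have {}AL : A < L%:R by apply: lt_le_trans (truncnS_gt _) _; rewrite ler_nat.
have a1 : 0 < 2 * lam / e by rewrite divr_gt0// mulr_gt0.
have a2 : 0 <= 4 * lam * `|ln c| / e by rewrite divr_ge0 ?mulr_ge0// ltW.
have L0 : 0 < L%:R :> R by rewrite /A in AL; lra.
have L1 : 2 * lam / e < L%:R by rewrite /A in AL; lra.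
have L2 : 4 * lam * `|ln c| / e < L%:R by rewrite /A in AL; lra.
have L3 : 2 * mu < L%:R by rewrite /A in AL; lra.
have pw : expR (- (2 * eta * L%:R)) <= w L * r ^+ L.
  have -> : expR (- (2 * eta * L%:R)) = expR (- eta) ^+ L / expR eta ^+ L.
    by rewrite -!expRM_natr -expRB; congr expR; ring.
  by rewrite ler_pdivrMr ?exprn_gt0 ?expR_gt0// -mulrA -exprMn.
have pw0 : 0 < w L * r ^+ L by apply: lt_le_trans pw; apply: expR_gt0.
have lnp : ln c - 2 * eta * L%:R <= ln (c * (w L * r ^+ L)).
  rewrite lnM ?posrE// lerD2l -ler_expR lnK ?posrE//.
pose d := 2 * lam / L%:R.
have d0 : 0 < d by rewrite divr_gt0// mulr_gt0.
have dL : d * L%:R = 2 * lam by rewrite divfK// gt_eqF.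
exists L, d; split => //.
- by move: L1; rewrite /d !ltr_pdivrMr// [e * _]mulrC.
- rewrite dL; have : d * mu < lam by rewrite /d mulrAC ltr_pdivrMr//; nra.
  lra.
- by rewrite mulr_gt0.
- have h1 : d * `|ln c| <= e / 2.
    rewrite /d mulrAC ler_pdivrMr// -ler_pdivrMl ?divr_gt0//.
    apply: le_trans (ltW L2); rewrite le_eqVlt; apply/orP; left; apply/eqP.
    by field; exact: lt0r_neq0.
  have h2 := ler_wpM2l (ltW d0) lnp.
  have h3 : d * - ln c <= d * `|ln c| by rewrite ler_wpM2l ?(ltW d0)// -normrN ler_norm.
  have h4 : d * (2 * eta * L%:R) = e / 2.
    have -> : d * (2 * eta * L%:R) = (d * L%:R) * (2 * eta) by ring.
    by rewrite dL -etaE; field.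
  lra.
Qed.

(** With mean [lam], the missing amount is just [d * lam], so one fixed [L > lam] serves and [d]
    alone is made small. *)
Lemma growth_at_mean {R : realType} (p : nat -> R) (lam e : R) (L : nat) :
  lam < L%:R -> 0 < p L -> 0 < e -> exists (L : nat) (d : R),
    [/\ 0 < d, d < e, lam - (1 - d) * lam < d * L%:R, 0 < p L &
        - (d * ln (p L)) <= e].
Proof.
move=> lL pL e0; pose l := `|ln (p L)|.
have l1 : 0 <= l by apply: normr_ge0.
have l0 : 0 < 2 * (1 + l) by rewrite mulr_gt0// ltr_wpDr.
pose d := e / (2 * (1 + l)).
have d0 : 0 < d by rewrite divr_gt0.
have dE : d * (2 * (1 + l)) = e by rewrite divfK// gt_eqF.
have dl : 0 <= d * l by rewrite mulr_ge0// ltW.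
exists L, d; split => //; first lra.
  have : d * lam < d * L%:R by rewrite ltr_pM2l.
  lra.
have : d * - ln (p L) <= d * l by rewrite ler_wpM2l ?(ltW d0)// /l -normrN ler_norm.
lra.
Qed.

Lemma growth_of_rho0 {R : realType} (w : nat -> R) : (forall k, 0 <= w k) ->
  rho w = 0%:E ->
  forall (B : R) (L0 : nat), 0 < B -> exists L, (L0 <= L)%N /\ B ^+ L <= w L.
Proof.
(* At x = 1/(2B), where Phi diverges, comparison with the ratio 1/2 gives w_L >= (2B)^L / 2^L =
   B^L. *)
move=> w0 rE B L0 B0; pose x := (2 * B)^-1.
have b0 : 0 < 2 * B by rewrite mulr_gt0.
have x0 : 0 < x by rewrite invr_gt0.
have Px : PhiE w x = +oo%E.
  apply/eqP; rewrite -leye_eq leNgt; apply/negP => fin.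
  by have := PhiE_fin_le_rho w x (ltW x0) fin; rewrite rE lee_fin leNgt x0.
have [||L [L0L HL]] := weight_growth w x 2^-1 L0 w0 (ltW x0) Px; first by rewrite invr_ge0.
  by rewrite invf_lt1 ?ltr1n.
exists L; split => //; move: HL; rewrite /x !exprVn ler_pdivlMr ?exprn_gt0//.
by rewrite exprMn mulrA mulVf ?mul1r// expf_neq0.
Qed.

(** * Occupancy for positive and for zero tau, and the theorem *)

Lemma tilted_occupancy {R : realType} (w : nat -> R) (m : nat -> nat)
    (lam tau mu : R) (k : nat) (eps : R) :
  (forall k, 0 <= w k) -> 0 < w 0%N -> 0 < tau -> (tau%:E <= rho w)%E ->
  (PhiE w tau < +oo)%E -> PsiE w tau = mu%:E ->
  (fun n => (m n)%:R / n%:R : R) @ \oo --> lam -> 0 < lam ->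
  (lam%:E < omega w)%E -> mu = lam \/ mu < lam /\ tau%:E = rho w -> 0 < eps ->
  eventually_unlikely w m
    (fun n y => eps < `| (Nk k y)%:R / n%:R - w k * tau ^+ k / fine (PhiE w tau) |).
Proof.
move=> w0 w00 tau0 tr fin Pmu cvm lam0 lo cases eps0.
have m0 := moment_ge0 w w0.
have mu0 : 0 <= mu by rewrite -lee_fin -Pmu PsiE_ge0// ltW.
have fin1 : (PhiE (moment w) tau < +oo)%E.
  rewrite ltey; apply/eqP => e; move: Pmu.
  by rewrite PsiE_infty// ltW.
have S0 := fine_PhiE_gt0 w tau w0 w00 (ltW tau0) fin.
pose c := (fine (PhiE w tau))^-1; have c0 : 0 < c by rewrite invr_gt0.
pose p k := c * (w k * tau ^+ k).
have pE j : w j * tau ^+ j / fine (PhiE w tau) = p j by rewrite mulrC.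
have p0 j : 0 <= p j by rewrite mulr_ge0 ?mulr_ge0 ?exprn_ge0// ltW.
have sum_le N : \sum_(j < N) p j <= 1.
  rewrite -mulr_sumr mulrC ler_pdivrMr// mul1r -lee_fin PhiE_fineK//; last exact: ltW.
  by apply: PhiE_ge_partial => //; apply: ltW.
have p01 j : 0 <= p j <= 1.
  rewrite p0 /=; apply: le_trans (sum_le j.+1).
  by rewrite big_ord_recr /= lerDr sumr_ge0.
have p00 : 0 < p 0%N by rewrite mulr_gt0// mulr_gt0// exprn_gt0.
have cp : series p @ \oo --> (1 : R).
  have -> : series p = fun n => c * pseries w tau n.
    by apply/funext => n; rewrite /pseries /series /= mulr_sumr.
  rewrite -(mulVf (lt0r_neq0 S0)); apply: cvgMr.
  exact: pseries_cvg_fine (ltW tau0) fin.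
have cp1 : series (fun k => k%:R * p k) @ \oo --> mu.
  have -> : series (fun k => k%:R * p k) = fun n => c * pseries (moment w) tau n.
    apply/funext => n; rewrite /pseries /series /= mulr_sumr.
    by apply: eq_bigr => i _; rewrite /p /moment; ring.
  have -> : mu = c * fine (PhiE (moment w) tau).
    by move: Pmu; rewrite PsiE_fin ?(ltW tau0)// => -[<-]; rewrite mulrC.
  by apply: cvgMr; apply: pseries_cvg_fine (ltW tau0) fin1.
have mulam : mu <= lam by case: cases => [->//|[/ltW]].
have grow e : 0 < e -> exists (L : nat) (d : R),
    [/\ 0 < d, d < e, lam - (1 - d) * mu < d * L%:R, 0 < p L &
        - (d * ln (p L)) <= e].
  move=> e0; case: cases => [->|[_ tE]]; last exact: growth_at_boundary.
  have /ereal_sup_gt[_ [L /= wL <-]] := lo; rewrite lte_fin => lL.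
  by apply: (growth_at_mean p lam e L) => //; rewrite mulr_gt0// mulr_gt0// exprn_gt0.
have Zlow := Z_subexponential p m lam mu p01 p00 cp cp1 cvm mu0 mulam lam0 grow.
rewrite pE => delta delta0.
have [N HN] := occupancy_lln p m k eps p0 sum_le Zlow eps0 delta delta0.
exists N => n Nn Zn.
rewrite -(Prob_tilt w c tau) ?gt_eqF//; apply: HN => //.
by rewrite /p Z_tilt !mulr_gt0 ?exprn_gt0.
Qed.

Lemma degenerate_occupancy {R : realType} (w : nat -> R) (m : nat -> nat)
    (lam : R) (k : nat) (eps : R) :
  (forall k, 0 <= w k) -> 0 < w 0%N ->
  (fun n => (m n)%:R / n%:R : R) @ \oo --> lam ->
  lam = 0 \/ rho w = 0%:E -> 0 < eps ->
  eventually_unlikely w m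
    (fun n y => eps < `| (Nk k y)%:R / n%:R - w k * 0 ^+ k / fine (PhiE w 0) |).
Proof.
move=> w0 w00 cvm cases eps0; rewrite PhiE0 /=.
(* As 0^0 = 1, the law for [tau = 0] is the point mass at 0. *)
have -> : w k * 0 ^+ k / w 0%N = (k == 0%N)%:R.
  rewrite expr0n; case: eqP => [->|_]; last by rewrite mulr0 mul0r.
  by rewrite mulr1 divff// gt_eqF.
apply: (occupancy_point_mass _ _ lam) => // j e j0 e0.
case: cases => [l0|r0]; first by apply: Nk_unlikely_sparse => //; rewrite -l0.
by apply: Nk_unlikely_of_growth => //; exact: growth_of_rho0.
Qed.

Theorem theorem10p4 (R : realType) (w : nat -> R) (m : nat -> nat) (lam : R) :
  (forall k, 0 <= w k) -> 0 < w 0%N -> (exists k, (1 <= k)%N /\ 0 < w k) ->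
  (fun n => (m n)%:R / n%:R : R) @ \oo --> lam ->
  0 <= lam -> (lam%:E < omega w)%E ->
  exists tau : R,
    [/\ ((lam%:E <= nu w)%E ->
          [/\ 0 <= tau, (tau%:E <= rho w)%E, PsiX w tau = lam%:E &
              forall t : R, 0 <= t -> (t%:E <= rho w)%E ->
                PsiX w t = lam%:E -> t = tau]),
        ((nu w < lam%:E)%E -> tau%:E = rho w),
        0 <= tau,
        (0 < PhiE w tau)%E & (PhiE w tau < +oo)%E] /\
    let pi := fun k : nat => w k * tau ^+ k / fine (PhiE w tau) in
    [/\ (forall k, 0 <= pi k) /\ (\sum_(k <oo) (pi k)%:E)%E = 1%E,
        (\sum_(k <oo) (k%:R * pi k)%:E)%E = PsiX w tau,
        PsiX w tau = Order.min lam%:E (nu w),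
        (\sum_(k <oo) (((k%:R - fine (PsiX w tau)) ^+ 2 * pi k)%:E))%E
          = (tau%:E * PsiD w tau)%E &
        forall (k : nat) (eps delta : R), 0 < eps -> 0 < delta ->
          exists N : nat, forall n : nat, (N <= n)%N -> 0 < Z w (m n) n ->
            Prob w (fun y : {ffun 'I_n -> 'I_(m n).+1} => eps < `| (Nk k y)%:R / n%:R - pi k |) < delta].
Proof.
move=> w0 w00 wk cvm lam0 lo.
have [tau [tau0 tr fin PX cases]] := exists_tau w lam w0 w00 wk lam0 lo.
have S0 := fine_PhiE_gt0 w tau w0 w00 tau0 fin.
have m0 := moment_ge0 w w0.
have [c Pc] : exists c, PsiE w tau = c%:E.
  have := PsiE_ge0 w tau w0 tau0.
  case: cases => [[_ ->]|[nl _ ->]]; first by exists lam.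
  by case: (nu w) nl => // r _ _; exists r.
have piE k : w k * tau ^+ k / fine (PhiE w tau) =
    (fine (PhiE w tau))^-1 * (w k * tau ^+ k) by rewrite mulrC.
have Vinv : (((fine (PhiE w tau))^-1)%:E * PhiE w tau = 1)%E.
  by rewrite -[X in (_ * X)%E]PhiE_fineK// -EFinM mulVf// gt_eqF.
exists tau; split; first split => //.
- move=> lnu; case: cases => [[_ Pl]|[nl]]; last by rewrite ltNge lnu in nl.
  split => //; first by rewrite PX.
  move=> t t0 tr' Pt; have [h|[h|//]] : t < tau \/ tau < t \/ t = tau.
    by case: (ltgtP t tau) => ?; [left|right; left|right; right].
  + have := PsiX_increasing w t tau w0 w00 wk t0 h tr.
    by rewrite Pt PX Pl ltxx.
  + have := PsiX_increasing w tau t w0 w00 wk tau0 h tr'.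
    by rewrite Pt PX Pl ltxx.
- by move=> nl; case: cases => [[ln _]|[]//]; rewrite ltNge ln in nl.
- by rewrite -PhiE_fineK// lte_fin.
split.
- split=> [k|]; first by rewrite divr_ge0 ?mulr_ge0 ?exprn_ge0// ltW.
  rewrite -[RHS]Vinv -nneseries_scaled//.
  by apply: eq_eseriesr => k _; rewrite piE.
- rewrite PX /PsiE muleC -nneseries_scaled//.
  by apply: eq_eseriesr => k _; rewrite piE; congr EFin; ring.
- rewrite PX; case: cases => [[lnu ->]|[nl _ ->]].
    by rewrite min_l.
  by rewrite min_r// ltW.
- rewrite PX Pc /= -(centred_tau w tau c)// muleC -nneseries_scaled//; last exact: centred_ge0.
  by apply: eq_eseriesr => k _; rewrite piE /centred; congr EFin; ring.
move=> k eps delta eps0 delta0; move: delta delta0.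
have [te0|tn0] := eqVneq tau 0.
  rewrite te0; apply: (degenerate_occupancy w m lam) => //.
  (* For [lam != 0], [tau = 0] cannot solve Psi(tau) = lam because Psi(0) = 0; so [tau] is the
     radius and [rho = 0]. *)
  have [l0|l0] := eqVneq lam 0; [by left|right].
  case: cases => [[_]|[_ <- _]]; last by rewrite te0.
  by rewrite te0 PsiE0 => -[l0']; rewrite -l0' eqxx in l0.
have {}tau0 : 0 < tau by rewrite lt_neqAle eq_sym tn0.
apply: (tilted_occupancy w m lam tau c) => //.
(* Positivity of [lam]: either it equals Psi(tau) > Psi(0) = 0, or it exceeds nu >= 0. *)
- case: cases => [[_ Pl]|[nl _ Pn]].
    have := PsiE_lt w 0 tau w0 w00 wk (lexx _) tau0 fin.
    by rewrite PsiE0 Pl lte_fin.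
  by rewrite -lte_fin; apply: le_lt_trans nl; rewrite -Pn PsiE_ge0// ltW.
- case: cases => [[_ Pl]|[nl tE Pn]]; [left|right].
    by move: Pl; rewrite Pc => -[].
  by split => //; rewrite -lte_fin -Pc Pn.
Qed.
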